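(* Let $m\ge2$, $n\ge0$, and $0\le k\le n$. For the particle-number-resolving (PNR) measurement, the frame-operator eigenvalue $$s_{\lambda_k}:=\frac{1}{d_{\lambda_k}}\sum_{\vec n\in\mathbb N^m}\langle\!\langle \vec n,\vec n|P_{\lambda_k}|\vec n,\vec n\rangle\!\rangle$$ equals $$s_{\lambda_k}=\frac{m-1}{2k+m-1}\,\binom{k+m-2}{k}^{-1}.$$
   Context: Fix integers $m\ge 2$ and $n\ge 0$. $\mathcal H_n^m$ is the span of the Fock states $|\vec n\rangle=|n_1,\dots,n_m\rangle$ with $\vec n\in\mathbb N^m$, $\sum_i n_i=n$. $\tau_n^m$ denotes the totally symmetric irreducible representation of $\mathrm{SU}(m)$ on $\mathcal H_n^m$ induced by passive transformations, and $\omega_n^m(g)(X):=\tau_n^m(g)X\tau_n^m(g)^\dagger$ on $\mathcal B(\mathcal H_n^m)$, identified via vectorization $|A\rangle\!\rangle=\sum\langle\vec n|A|\vec m\rangle|\vec n\rangle\otimes|\vec m\rangle$ with $\tau_n^m\otimes\bar\tau_n^m$; $|\vec n,\vec n\rangle\!\rangle$ is the vectorization of $|\vec n\rangle\langle\vec n|$. $\omega_n^m$ decomposes multiplicity-free as $\bigoplus_{k=0}^n\lambda_k$, where $\lambda_k$ is the irrep of $\mathrm{SU}(m)$ with Young diagram $(2k,k,\dots,k,0)$ (first row $2k$ boxes, rows $2,\dots,m-1$ with $k$ boxes, empty last row), of dimension $d_{\lambda_k}$. $P_{\lambda_k}$ is the orthogonal (Hilbert–Schmidt) projector onto the $\lambda_k$-component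 of $\mathcal B(\mathcal H_n^m)$, extended by zero to operators on other particle-number sectors. *)

(* Defs.v *)
(* complex numbers C = R[i] for a realType R (e.g. Stdlib's R). *)
From HB Require Import structures.
From mathcomp Require Import all_boot all_order all_algebra all_fingroup.
From mathcomp Require Import complex.
From mathcomp Require Import reals.

Set Implicit Arguments.
Unset Strict Implicit.
Unset Printing Implicit Defensive.

Import Order.TTheory GRing.Theory Num.Theory.
Local Open Scope ring_scope.

(* Fock states: occupation vectors n = (n_1,...,n_m) with sum n.            *)
Definition occ (m n : nat) : finType :=
  {f : {ffun 'I_m -> 'I_n.+1} | (\sum_(j < m) (f j : nat))%N == n}.

(* number of particles in mode j *)
Definition cnt m n (x : occ m n) (j : 'I_m) : nat := val x j.

(* dimension of H_n^m *)
Definition dimH (m n : nat) : nat := #|occ m n|.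

(* the Fock state indexed by a : 'I_(dimH m n) (orthonormal basis of H_n^m) *)
Definition fock m n (a : 'I_(dimH m n)) : occ m n := enum_val a.

Section Fock.
Variable R : realType.
Local Notation C := R[i].
Local Open Scope complex_scope.
Variables m n : nat.
Local Notation D := (dimH m n).
Local Notation cn a j := (cnt (@fock m n a) j).

(* Operators on H_n^m are D x D matrices A with A a b = <a|A|b>. *)

(* conjugate transpose *)
Definition adjmx p q (A : 'M[C]_(p, q)) : 'M[C]_(q, p) :=
  (map_mx (fun z : C => z^*) A)^T.

(* a^dagger_i a_j restricted to H_n^m:
   a^dag_i a_j |b> = sqrt(b_j (b_i - [i=j] + 1)) |b - e_j + e_i>,
   i.e. <a| a^dag_i a_j |b> = sqrt(b_j * a_i) if a = b - e_j + e_i, else 0. *)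
Definition hop (i j : 'I_m) : 'M[C]_D :=
  \matrix_(a, b)
    if [forall l : 'I_m, (cn a l)%:Z == (cn b l)%:Z + (l == i)%:Z - (l == j)%:Z]
    then (Num.sqrt (((cn b j) * (cn a i))%:R : R))%:C
    else 0.

(* number operator N_i = a^dag_i a_i *)
Definition numop (i : 'I_m) : 'M[C]_D := hop i i.

(* the list of modes of a Fock state, each mode j repeated n_j times *)
Definition modes (x : occ m n) : seq 'I_m :=
  flatten [seq nseq (cnt x j) j | j <- enum 'I_m].

(* passive transformation tau_n^m(U): a^dag_j |-> sum_i U_ij a^dag_i, with
   <a|tau(U)|b> = Per(U[a|b]) / sqrt(prod_i a_i! prod_j b_j!)   *)
Definition entry (U : 'M[C]_m) (oi oj : option 'I_m) : C :=
  match oi, oj with Some i, Some j => U i j | _, _ => 0 end.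

Definition tau (U : 'M[C]_m) : 'M[C]_D :=
  \matrix_(a, b)
    ((\sum_(s : 'S_n) \prod_(t < n)
        entry U (nth None (map Some (modes (@fock m n a))) t)
                (nth None (map Some (modes (@fock m n b))) (s t)))
     / (Num.sqrt ((\prod_(j < m) ((cn a j)`! * (cn b j)`!))%N%:R : R))%:C).

(* special unitary group SU(m) *)
Definition SU (U : 'M[C]_m) : Prop :=
  U *m adjmx U = 1%:M /\ \det U = 1.

(* omega_n^m(U)(X) = tau(U) X tau(U)^dagger *)
Definition omega (U : 'M[C]_m) (X : 'M[C]_D) : 'M[C]_D :=
  tau U *m X *m adjmx (tau U).

(* Young diagram lambda_k = (2k, k, ..., k, 0) (m rows) *)
Definition lam (k : nat) (i : 'I_m) : nat :=
  if val i == 0%N then (2 * k)%N else if val i == m.-1 then 0%N else k.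

(* X is a highest weight vector for the (complexified) infinitesimal action
   X |-> [a^dag_i a_j, X] of omega, of SU(m)-highest weight given by the
   Young diagram lam (weights of SU(m) are taken modulo (1,...,1)). *)
Definition hw_vector (lamb : 'I_m -> nat) (X : 'M[C]_D) : Prop :=
  X != 0 /\
  (exists w : 'I_m -> int,
     (forall i, numop i *m X - X *m numop i = (w i)%:~R *: X) /\
     (forall i j, w i - w j = (lamb i)%:Z - (lamb j)%:Z)) /\
  (forall i j : 'I_m, (i < j)%N -> hop i j *m X - X *m hop i j = 0).

(* W (a subspace of vectorized operators B(H_n^m), as row space) is the
   lambda_k-component of omega_n^m: the smallest subspace containing
   omega(U) X for every U in SU(m) and every highest weight vector X
   of highest weight lambda_k. *)
Definition lam_component (k : nat) (W : 'M[C]_(D * D)) : Prop :=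
  (forall U X, SU U -> hw_vector (lam k) X -> (mxvec (omega U X) <= W)%MS) /\
  (forall V : 'M[C]_(D * D),
     (forall U X, SU U -> hw_vector (lam k) X -> (mxvec (omega U X) <= V)%MS) ->
     (W <= V)%MS).

(* P is the orthogonal (Hilbert-Schmidt) projector onto the row space W,
   acting on row vectors v |-> v *m P (mxvec is the vectorization |A>>). *)
Definition orth_projector (W P : 'M[C]_(D * D)) : Prop :=
  P *m P = P /\ adjmx P = P /\ (P == W)%MS.

(* frame-operator eigenvalue s = (1/d) sum_n <<n,n|P|n,n>>, with d = dim W *)
Definition frame_eig (P : 'M[C]_(D * D)) : C :=
  (\rank P)%:R^-1 * \sum_(a < D) P (mxvec_index a a) (mxvec_index a a).

End Fock.

(* Main.v *)
(* An operator X on H_n is encoded by its symbol <u|X|v> at unnormalised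
   coherent vectors, a polynomial of bidegree (n, n) in (u, v); omega(U) acts on
   it by linear substitution.  The highest weight vectors of weight lambda_k are
   the multiples of (a^dag_1)^k (a_m)^k, so the lambda_k-component is spanned by
   the symbols (u.x)^k (w.z)^k (x.z)^(n-k), where u and w are the first column and
   the conjugate of the last column of U in SU(m).  Orthogonality of the two
   columns reads u.w = 0, and every complex solution of this equation is reached
   up to scaling.  Hence the component is dual to the polynomials of bidegree
   (k, k) restricted to the quadric u.w = 0, for which the monomials not divisible
   by u_1 w_1 form a basis.  This basis is graded by the torus weight, so the
   trace of P over the diagonal operators just counts the basis monomials
   u^a w^a.  With d the number of monomials of degree k and f the number of those
   without the first variable, s = f / (d^2 - (d - f)^2) = 1 / (2 d - f). *)
Require Import Defs.
From HB Require Import structures.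
From mathcomp Require Import all_boot all_order all_algebra all_fingroup.
From mathcomp Require Import complex.
From mathcomp Require Import reals.
From mathcomp Require Import spectral.
From mathcomp Require Import zify ring.
Import Order.TTheory GRing.Theory Num.Theory.
Local Open Scope ring_scope.

Set Implicit Arguments.
Unset Strict Implicit.
Unset Printing Implicit Defensive.

(** * Occupation vectors and monomials *)

Lemma sum_single (V : nmodType) (I : finType) (f : I -> V) i0 :
  (forall i, i != i0 -> f i = 0) -> \sum_i f i = f i0.
Proof. by move=> H; rewrite (bigD1 i0) //= big1 ?addr0. Qed.

Lemma cnt_inj m n (x y : occ m n) : (forall j, cnt x j = cnt y j) -> x = y.
Proof.
move=> exy; apply/val_inj/ffunP => j; apply/val_inj; exact: (exy j).
Qed.

Lemma sum_cnt m n (x : occ m n) : (\sum_(j < m) cnt x j)%N = n.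
Proof. exact: (eqP (valP x)). Qed.

Lemma cnt_le m n (x : occ m n) j : (cnt x j <= n)%N.
Proof. by rewrite -ltnS; apply: ltn_ord. Qed.

Lemma occ_of_subproof m n (f : 'I_m -> nat) : (\sum_j f j)%N = n ->
  {x : occ m n | forall j, cnt x j = f j}.
Proof.
move=> sf.
have fle j : (f j < n.+1)%N by rewrite ltnS -sf (bigD1 j) //= leq_addr.
pose g : {ffun 'I_m -> 'I_n.+1} := [ffun j => Ordinal (fle j)].
have gE j : (g j : nat) = f j by rewrite ffunE.
have H : (\sum_(j < m) (g j : nat))%N == n.
  by apply/eqP; rewrite -[RHS]sf; apply: eq_bigr => j _.
by exists (Sub g H : {h : {ffun 'I_m -> 'I_n.+1} |
  (\sum_(j < m) (h j : nat))%N == n}) => j; rewrite -gE.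
Qed.

Definition occ_of m n (f : 'I_m -> nat) (sf : (\sum_j f j)%N = n) : occ m n :=
  sval (occ_of_subproof sf).

Lemma occ_ofE m n (f : 'I_m -> nat) (sf : (\sum_j f j)%N = n) j :
  cnt (occ_of sf) j = f j.
Proof. exact: (svalP (occ_of_subproof sf) j). Qed.

Lemma occ_add_subproof m k r (x : occ m k) (y : occ m r) :
  (\sum_j (cnt x j + cnt y j))%N = (k + r)%N.
Proof. by rewrite big_split /= !sum_cnt. Qed.

Definition occ_add m k r (x : occ m k) (y : occ m r) : occ m (k + r) :=
  occ_of (occ_add_subproof x y).

Lemma occ_addE m k r (x : occ m k) (y : occ m r) j :
  cnt (occ_add x y) j = (cnt x j + cnt y j)%N.
Proof. exact: occ_ofE. Qed.

Lemma occ_single_subproof m k (i : 'I_m) :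
  (\sum_(j < m) (if j == i then k else 0))%N = k.
Proof. by rewrite -big_mkcond big_pred1_eq. Qed.

Definition occ_single m k (i : 'I_m) : occ m k :=
  occ_of (occ_single_subproof k i).

Lemma occ_singleE m k (i j : 'I_m) :
  cnt (occ_single k i) j = if j == i then k else 0%N.
Proof. exact: occ_ofE. Qed.

Definition occ_incr m k (i : 'I_m) (y : occ m k) : occ m k.+1 :=
  occ_add (occ_single 1 i) y.

Lemma occ_incrE m k i (y : occ m k) j :
  cnt (occ_incr i y) j = ((j == i) + cnt y j)%N.
Proof.
apply: etrans (occ_addE (occ_single 1 i) y j) _.
by rewrite occ_singleE; case: eqP.
Qed.

Lemma occ_predP m k (x : occ m k.+1) i : (0 < cnt x i)%N ->
  exists y : occ m k, x = occ_incr i y.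
Proof.
move=> xi; pose f j := (cnt x j - (j == i))%N.
have fE j : ((j == i) + f j = cnt x j)%N.
  by rewrite /f; case: eqP => [->|_]; lia.
have sf : (\sum_j f j)%N = k.
  have : (\sum_j ((if j == i then 1 else 0) + f j) = \sum_j cnt x j)%N.
    by apply: eq_bigr => j _; rewrite -fE; case: eqP.
  by rewrite big_split /= sum_cnt occ_single_subproof add1n => -[].
by exists (occ_of sf); apply: cnt_inj => j; rewrite occ_incrE occ_ofE fE.
Qed.

Lemma fock_inj m n : injective (@fock m n).
Proof. exact: enum_val_inj. Qed.

Lemma fock_rank m n (x : occ m n) : fock (enum_rank x) = x.
Proof. exact: enum_rankK. Qed.

Lemma sum_fock (V : nmodType) m n (g : occ m n -> V) :
  \sum_(a < dimH m n) g (fock a) = \sum_(x : occ m n) g x.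
Proof. by rewrite -(big_enum_val g). Qed.

Definition occ_fact m n (x : occ m n) : nat := (\prod_j (cnt x j)`!)%N.

Lemma occ_fact_gt0 m n (x : occ m n) : (0 < occ_fact x)%N.
Proof. by apply: prodn_gt0 => j; apply: fact_gt0. Qed.

Section Monomials.
Variable F : comNzRingType.

Definition mon m n (x : 'I_m -> F) (a : occ m n) : F := \prod_j x j ^+ cnt a j.

Lemma eq_mon m n (x y : 'I_m -> F) (a : occ m n) : x =1 y -> mon x a = mon y a.
Proof. by move=> xy; apply: eq_bigr => j _; rewrite xy. Qed.

Lemma mon_add m k r (x : 'I_m -> F) (a : occ m k) (b : occ m r) :
  mon x (occ_add a b) = mon x a * mon x b.
Proof.
rewrite /mon -big_split; apply: eq_bigr => j _.
by rewrite occ_addE exprD.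
Qed.

Lemma mon_single m k (x : 'I_m -> F) i : mon x (occ_single k i) = x i ^+ k.
Proof.
rewrite /mon (bigD1 i) //= big1 ?mulr1 => [|j /negPf ji].
  by rewrite occ_singleE eqxx.
by rewrite occ_singleE ji.
Qed.

Lemma mon_mul m n (x y : 'I_m -> F) (a : occ m n) :
  mon (fun j => x j * y j) a = mon x a * mon y a.
Proof.
by rewrite /mon -big_split; apply: eq_bigr => j _; rewrite exprMn.
Qed.

Lemma mon_scale m n (c : F) (x : 'I_m -> F) (a : occ m n) :
  mon (fun j => c * x j) a = c ^+ n * mon x a.
Proof.
rewrite /mon -[in c ^+ n](sum_cnt a) -prodrXr -big_split.
by apply: eq_bigr => j _; rewrite exprMn.
Qed.
End Monomials.

Lemma mon_incr (F : comNzRingType) m k (u : 'I_m -> F) i (y : occ m k) :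
  mon u (occ_incr i y) = u i * mon u y.
Proof.
apply: etrans (mon_add u (occ_single 1 i) y) _.
by rewrite mon_single.
Qed.

(** * Linear independence of monomials, tested at positive integer points *)

Section Independence.
Variable F : numFieldType.

(** The sum is a polynomial in [t] with infinitely many roots, so each coefficient vanishes; the one
    of degree [q] collects the [i] with [p i = q]. *)
Lemma sum_pow_eq0 (I : finType) (p : I -> nat) (c : I -> F) :
  (forall t : nat, (0 < t)%N -> \sum_i c i * t%:R ^+ p i = 0) ->
  forall q, \sum_(i | p i == q) c i = 0.
Proof.
move=> H q; pose P : {poly F} := \sum_i c i *: 'X^(p i).
have P0 : P = 0.
  pose s : seq F := [seq t.+1%:R | t <- iota 0 (size P)].
  apply: (@roots_geq_poly_eq0 _ P s).
  - apply/allP => _ /mapP[t _ ->]; rewrite /root /P horner_sum.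
    apply/eqP; rewrite -[RHS](H t.+1) //; apply: eq_bigr => i _.
    by rewrite hornerZ hornerXn.
  - by rewrite map_inj_uniq ?iota_uniq // => t u /eqP; rewrite eqr_nat => /eqP[].
  - by rewrite size_map size_iota.
have : P`_q = 0 by rewrite P0 coef0.
rewrite /P coef_sum => {2}<-; rewrite big_mkcond; apply: eq_bigr => i _.
by rewrite coefZ coefXn eq_sym; case: (q == p i); rewrite ?mulr1 ?mulr0.
Qed.

(* Positive integer points suffice, so a factor such as (x.z)^r can be cancelled
   before this is applied. *)
Lemma monomials_free (I J : finType) (e : I -> J -> nat) (c : I -> F) :
  (forall i i', e i =1 e i' -> i = i') ->
  (forall x : J -> nat, (forall j, (0 < x j)%N) ->
     \sum_i c i * \prod_j (x j)%:R ^+ e i j = 0) ->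
  forall i, c i = 0.
Proof.
move=> inj_e H i0.
(* Invariant: the variables in s have been eliminated, keeping only the exponents of i0. *)
have step (s : seq J) : uniq s -> forall x : J -> nat, (forall j, (0 < x j)%N) ->
    \sum_(i | all (fun j => e i j == e i0 j) s)
       c i * \prod_(j | j \notin s) (x j)%:R ^+ e i j = 0.
  elim: s => [_ x x0|j s IH /= /andP[js us] x x0].
    by rewrite -[RHS](H x).
  pose c' i := if all (fun j => e i j == e i0 j) s then
     c i * \prod_(j' | j' \notin j :: s) (x j')%:R ^+ e i j' else 0.
  have := @sum_pow_eq0 I (fun i => e i j) c' _ (e i0 j).
  rewrite /c' -big_mkcondr /= => H1; apply: H1 => t t0.
  pose y j' := if j' == j then t else x j'.
  have y0 j' : (0 < y j')%N by rewrite /y; case: ifP.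
  rewrite -[RHS](IH us y y0) [RHS]big_mkcond; apply: eq_bigr => i _.
  case: ifP => _; last by rewrite mul0r.
  rewrite -mulrA; congr (_ * _); rewrite mulrC [RHS](bigD1 j) //=.
  rewrite {1}/y eqxx; congr (_ * _); apply: eq_big => j'.
    by rewrite inE negb_or andbC.
  by rewrite inE negb_or /y => /andP[/negPf ->].
have := step (index_enum J) (index_enum_uniq J) (fun=> 1%N) (fun=> erefl).
have all_i0 i : all (fun j => e i j == e i0 j) (index_enum J) = (i == i0).
  apply/allP/eqP => [ei|-> //]; apply: inj_e => j.
  by apply/eqP/ei; rewrite mem_index_enum.
under eq_bigl do rewrite all_i0.
by rewrite big_pred1_eq big1 ?mulr1 // => j; rewrite mem_index_enum.
Qed.

Lemma monomials2_free (I : finType) m (e f : I -> 'I_m -> nat) (c : I -> F) :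
  (forall i i', e i =1 e i' -> f i =1 f i' -> i = i') ->
  (forall x z : 'I_m -> nat, (forall j, (0 < x j)%N) -> (forall j, (0 < z j)%N) ->
     \sum_i c i * (\prod_j (x j)%:R ^+ e i j * \prod_j (z j)%:R ^+ f i j) = 0) ->
  forall i, c i = 0.
Proof.
move=> inj H.
apply: (@monomials_free I ('I_m + 'I_m)%type
  (fun i s => match s with inl j => e i j | inr j => f i j end)).
  by move=> i i' ee; apply: inj => j; [apply: (ee (inl j)) | apply: (ee (inr j))].
move=> x x0; rewrite -[RHS](H (x \o inl) (x \o inr)) => // [|j|j]; try exact: x0.
by apply: eq_bigr => i _; rewrite big_sumType.
Qed.
End Independence.

(** * Permanents *)

Section Permanent.

Lemma sum_perm_lift (V : nmodType) n (g : 'S_n.+1 -> V) :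
  \sum_s g s = \sum_(i < n.+1) \sum_(s : 'S_n) g (lift_perm ord0 i s).
Proof.
pose h (p : 'I_n.+1 * 'S_n) := lift_perm ord0 p.1 p.2.
have inj_h : injective h.
  move=> [i s] [j t] /permP /= e.
  have eij : i = j by have := e ord0; rewrite /h /= !lift_perm_id.
  rewrite -eij in e *; congr (_, _); apply/permP => x.
  by have := e (lift ord0 x); rewrite /h /= !lift_perm_lift; apply: lift_inj.
have bij_h : bijective h.
  by apply: inj_card_bij => //; rewrite card_prod !card_Sn card_ord factS.
by rewrite pair_big /= (reindex h) //; apply: onW_bij.
Qed.

(** Permutations with [be \o s = f] permute each fibre freely. In the induction, the image of 0
    ranges over the fibre of [f ord0], and removing it lowers only that fibre by one. *)
Lemma card_perm_match (T : finType) n (be f : 'I_n -> T) :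
  (forall j, \sum_t (be t == j) = \sum_t (f t == j))%N ->
  (\sum_(s : 'S_n) \prod_t (be (s t) == f t) = \prod_j (\sum_t (f t == j))`!)%N.
Proof.
elim: n be f => [|n IH] be f H.
  rewrite [RHS]big1 => [|j _]; last by rewrite big_ord0.
  under eq_bigr do rewrite big_ord0.
  by rewrite -[RHS](card_Sn 0) -sum1_card; apply: eq_bigl.
rewrite (sum_perm_lift (V := nat)).
have -> : (\sum_(i < n.+1) \sum_(s : 'S_n)
    \prod_t (be (lift_perm ord0 i s t) == f t) =
   \sum_(i < n.+1) (be i == f ord0) * \prod_j (\sum_t (f (lift ord0 t) == j))`!)%N.
  apply: eq_bigr => i _; case: (eqVneq (be i) (f ord0)) => [ei|ni]; last first.
    rewrite mul0n big1 // => s _.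
    by rewrite big_ord_recl lift_perm_id (negPf ni) mul0n.
  rewrite mul1n -(IH (be \o lift i)).
    apply: eq_bigr => s _; rewrite big_ord_recl lift_perm_id ei eqxx mul1n.
    by apply: eq_bigr => t _; rewrite lift_perm_lift.
  move=> j; apply/eqP; rewrite -(eqn_add2l (be i == j)); apply/eqP.
  rewrite [in RHS]ei; have := H j.
  by rewrite (bigD1_ord i) //= big_ord_recl.
rewrite -big_distrl /= H big_ord_recl eqxx (bigD1 (f ord0)) //=.
rewrite mulnA [in RHS](bigD1 (f ord0)) //= [in RHS]big_ord_recl eqxx add1n factS.
congr (_ * _)%N; apply: eq_bigr => j nj.
by rewrite [in RHS]big_ord_recl eq_sym (negPf nj).
Qed.

Variables m n : nat.
Implicit Types x y : occ m n.

Lemma big_modes (T : Type) (idx : T) (op : Monoid.com_law idx) x (g : 'I_m -> T) :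
  \big[op/idx]_(i <- modes x) g i = \big[op/idx]_j iter (cnt x j) (op (g j)) idx.
Proof.
rewrite /modes big_flatten big_map big_enum /=; apply: eq_bigr => j _.
by rewrite big_nseq.
Qed.

Lemma size_modes x : size (modes x) == n.
Proof.
apply/eqP; rewrite -[RHS](sum_cnt x) -sum1_size big_modes; apply: eq_bigr => j _.
by rewrite iter_addn_0 mul1n.
Qed.

Definition mode x (t : 'I_n) : 'I_m := tnth (Tuple (size_modes x)) t.

Lemma nth_modes x (t : 'I_n) : nth None (map Some (modes x)) t = Some (mode x t).
Proof.
have st : (t < size (modes x))%N by rewrite (eqP (size_modes x)).
rewrite (nth_map (mode x t)) //; congr Some.
by rewrite [in RHS]/mode (tnth_nth (mode x t)).
Qed.

Lemma big_mode (T : Type) (idx : T) (op : Monoid.com_law idx) x (g : 'I_m -> T) :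
  \big[op/idx]_t g (mode x t) = \big[op/idx]_j iter (cnt x j) (op (g j)) idx.
Proof. by rewrite -big_modes -(big_tuple _ _ (Tuple (size_modes x)) xpredT g). Qed.

Lemma count_mode x j : (\sum_t (mode x t == j))%N = cnt x j.
Proof.
rewrite (big_mode _ x (fun i => (i == j) : nat)) (bigD1 j) //= big1 => [|i /negPf ij].
  by rewrite eqxx iter_addn_0 mul1n addn0.
by rewrite ij iter_addn_0.
Qed.

Lemma prod_mode (F : comNzRingType) (g : 'I_m -> F) x :
  \prod_t g (mode x t) = mon g x.
Proof.
rewrite big_mode; apply: eq_bigr => j _.
by elim: (cnt x j) => //= k ->; rewrite exprS.
Qed.

(** Both sides expand over the functions [f : 'I_n -> 'I_m]. Only the occupation vector of the fibre
    sizes of [f] contributes, through exactly [occ_fact x] permutations, which cancels the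
    denominator. *)
Lemma permanent_coherent (F : numFieldType) (h : 'I_n -> 'I_m -> F) :
  \sum_(x : occ m n) (\sum_(s : 'S_n) \prod_t h t (mode x (s t))) / (occ_fact x)%:R =
  \prod_t \sum_j h t j.
Proof.
rewrite bigA_distr_bigA /=.
have h_match x (s : 'S_n) : \prod_t h t (mode x (s t)) =
   \sum_(f : {ffun 'I_n -> 'I_m}) (\prod_t (mode x (s t) == f t))%N%:R *
      \prod_t h t (f t).
  rewrite (bigD1 [ffun t => mode x (s t)]) //= [X in _ + X]big1 ?addr0.
    rewrite [X in X%:R]big1 ?mul1r => [|t _]; last by rewrite ffunE eqxx.
    by apply: eq_bigr => t _; rewrite ffunE.
  move=> f nf; case: (pickP (fun t => mode x (s t) != f t)) => [t nt|ef].
    by rewrite (bigD1 t) //= (negPf nt) mul0n mul0r.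
  case/eqP: nf; apply/ffunP => t; rewrite ffunE.
  by have /negbFE/eqP := ef t.
under eq_bigr do under eq_bigr do rewrite h_match.
under eq_bigr do rewrite exchange_big /= mulr_suml.
rewrite exchange_big /=; apply: eq_bigr => f _.
pose N x := (\sum_(s : 'S_n) \prod_t (mode x (s t) == f t))%N.
transitivity (\sum_x (N x)%:R / (occ_fact x)%:R * \prod_t h t (f t)).
  apply: eq_bigr => x _; rewrite -mulr_suml /N natr_sum mulrAC.
  by [].
rewrite -mulr_suml.
have sum_f : (\sum_j \sum_t (f t == j))%N = n.
  rewrite exchange_big /= -[RHS]card_ord -sum1_card; apply: eq_bigr => t _.
  rewrite (bigD1 (f t)) //= eqxx big1 ?addn0 // => j /negPf.
  by rewrite eq_sym => ->.
pose x0 := occ_of sum_f; rewrite (bigD1 x0) //= big1 ?addr0.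
  rewrite /N card_perm_match => [|j]; last by rewrite count_mode occ_ofE.
  rewrite /occ_fact; under [X in _ / X%:R]eq_bigr do rewrite occ_ofE.
  by rewrite divff ?mul1r // pnatr_eq0 -lt0n; apply: prodn_gt0 => j; apply: fact_gt0.
move=> x nx; rewrite /N big1 ?mul0r // => s _.
case: (pickP (fun t => mode x (s t) != f t)) => [t nt|ef].
  by rewrite (bigD1 t) //= (negPf nt) mul0n.
case/eqP: nx; apply: cnt_inj => j; rewrite occ_ofE -count_mode.
rewrite (reindex_inj (@perm_inj _ s)) /=; apply: eq_bigr => t _.
by have /negbFE/eqP -> := ef t.
Qed.

Lemma multinomial (F : numFieldType) (y : 'I_m -> F) :
  \sum_(x : occ m n) n`!%:R / (occ_fact x)%:R * mon y x = (\sum_j y j) ^+ n.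
Proof.
have := permanent_coherent (fun=> y); rewrite prodr_const card_ord => <-.
apply: eq_bigr => x _; rewrite mulrAC; congr (_ / _).
rewrite (eq_bigr (fun=> mon y x)) => [|s _].
  by rewrite sumr_const card_Sn mulr_natl.
by rewrite -prod_mode [RHS](reindex_inj (@perm_inj _ s)).
Qed.

End Permanent.

(** * Coherent vectors and symbols *)

Section Symbol.
Variable R : realType.
Local Notation C := R[i].

Section FixedNumber.
Variables m n : nat.
Local Notation D := (dimH m n).
Implicit Types (x y : occ m n) (u v z : 'I_m -> C) (U : 'M[C]_m) (A : 'M[C]_D).

Definition sqrt_fact x : C := (Num.sqrt (occ_fact x)%:R : R)%:C%C.

Lemma sqrt_fact_sq x : sqrt_fact x * sqrt_fact x = (occ_fact x)%:R.
Proof.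
rewrite /sqrt_fact -rmorphM -expr2 sqr_sqrtr ?ler0n //.
exact: rmorph_nat.
Qed.

Lemma sqrt_fact_neq0 x : sqrt_fact x != 0.
Proof.
apply/eqP => e; have := sqrt_fact_sq x; rewrite e mulr0 => /esym/eqP.
by rewrite pnatr_eq0 -leqn0 leqNgt occ_fact_gt0.
Qed.

Lemma tauE U a b : tau n U a b =
  (\sum_(s : 'S_n) \prod_t U (mode (fock a) t) (mode (fock b) (s t)))
  / (sqrt_fact (fock a) * sqrt_fact (fock b)).
Proof.
rewrite mxE; congr (_ / _).
  by apply: eq_bigr => s _; apply: eq_bigr => t _; rewrite !nth_modes.
by rewrite big_split /= natrM sqrtrM ?ler0n // rmorphM.
Qed.

(** Up to the factor sqrt(n!), this is the tensor power of [z] of order [n], written in the Fock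
    basis. *)
Definition coherent z : 'cV[C]_D := \col_a (mon z (fock a) / sqrt_fact (fock a)).

(** Summing the permanents against powers of [z] factorises by [permanent_coherent], one linear form
    per particle of the row index. *)
Lemma tau_coherent U z :
  tau n U *m coherent z = coherent (fun i => \sum_j U i j * z j).
Proof.
apply/matrixP => a i; rewrite !mxE.
rewrite -prod_mode -(permanent_coherent (fun t j => U (mode (fock a) t) j * z j)).
rewrite mulr_suml -sum_fock; apply: eq_bigr => b _; rewrite tauE !mxE.
have -> : \sum_(s : 'S_n) \prod_t (U (mode (fock a) t) (mode (fock b) (s t)) *
     z (mode (fock b) (s t))) =
   (\sum_(s : 'S_n) \prod_t U (mode (fock a) t) (mode (fock b) (s t))) *
     mon z (fock b).
  rewrite mulr_suml; apply: eq_bigr => s _; rewrite big_split /=; congr (_ * _).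
  by rewrite -prod_mode [RHS](reindex_inj (@perm_inj _ s)).
rewrite -sqrt_fact_sq; field.
by rewrite !sqrt_fact_neq0.
Qed.

Lemma tau_trmx U : (tau n U)^T = tau n U^T.
Proof.
apply/matrixP => a b; rewrite mxE !tauE; congr (_ / _); last by rewrite mulrC.
rewrite (reindex_inj invg_inj) /=; apply: eq_bigr => s _.
rewrite (reindex_inj (@perm_inj _ s)) /=; apply: eq_bigr => t _.
by rewrite permK mxE.
Qed.

Lemma tau_conj U : map_mx (@conjc R) (tau n U) = tau n (map_mx (@conjc R) U).
Proof.
apply/matrixP => a b; rewrite mxE !tauE fmorph_div rmorphM rmorph_sum /=.
congr (_ / (_ * _)); try exact: conjc_real.
apply: eq_bigr => s _; rewrite rmorph_prod; apply: eq_bigr => t _.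
by rewrite mxE.
Qed.

Lemma adj_tau U : adjmx (tau n U) = tau n (adjmx U).
Proof. by rewrite /adjmx tau_conj tau_trmx. Qed.

(* The bihomogeneous polynomial of bidegree (n, n) that represents the operator A. *)
Definition symbol A u v : C := ((coherent u)^T *m A *m coherent v) 0 0.

Lemma symbolE A u v : symbol A u v =
  \sum_p A p.1 p.2 / (sqrt_fact (fock p.1) * sqrt_fact (fock p.2)) *
    (mon u (fock p.1) * mon v (fock p.2)).
Proof.
rewrite /symbol -mulmxA !mxE.
rewrite -(pair_big xpredT xpredT (fun a b => A a b /
  (sqrt_fact (fock a) * sqrt_fact (fock b)) * (mon u (fock a) * mon v (fock b)))) /=.
apply: eq_bigr => a _; rewrite !mxE mulr_sumr; apply: eq_bigr => b _.
by rewrite !mxE; field; rewrite !sqrt_fact_neq0.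
Qed.

Lemma symbolZ c A u v : symbol (c *: A) u v = c * symbol A u v.
Proof. by rewrite /symbol -scalemxAr -scalemxAl mxE. Qed.

Lemma symbol_sum (I : finType) (P : pred I) (A : I -> 'M[C]_D) u v :
  symbol (\sum_(i | P i) A i) u v = \sum_(i | P i) symbol (A i) u v.
Proof. by rewrite /symbol mulmx_sumr mulmx_suml summxE. Qed.

Lemma symbolB A B u v : symbol (A - B) u v = symbol A u v - symbol B u v.
Proof. by rewrite /symbol mulmxBr mulmxBl !mxE. Qed.

(** Each entry of [A] is, up to a nonzero factor, the coefficient of its own monomial in the
    symbol. *)
Lemma symbol_eq0 A : (forall x z : 'I_m -> nat,
    (forall j, (0 < x j)%N) -> (forall j, (0 < z j)%N) ->
  symbol A (fun j => (x j)%:R) (fun j => (z j)%:R) = 0) -> A = 0.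
Proof.
move=> H; apply/matrixP => a b; rewrite mxE.
pose c (p : 'I_D * 'I_D) :=
  A p.1 p.2 / (sqrt_fact (fock p.1) * sqrt_fact (fock p.2)).
suff : c (a, b) = 0.
  move/eqP; rewrite mulf_eq0 invr_eq0 mulf_eq0 !(negPf (sqrt_fact_neq0 _)) /=.
  by rewrite orbF => /eqP.
move: (a, b); apply: (@monomials2_free _ _ m (fun p => cnt (fock p.1))
  (fun p => cnt (fock p.2))).
  move=> [a1 b1] [a2 b2] /= e f; congr (_, _); apply: fock_inj; exact: cnt_inj.
by move=> x z x0 z0; rewrite -[RHS](H x z) // symbolE.
Qed.

Lemma symbol_inj A B : (forall u v, symbol A u v = symbol B u v) -> A = B.
Proof.
move=> H; apply/eqP; rewrite -subr_eq0; apply/eqP/symbol_eq0 => x z _ _.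
by rewrite symbolB H subrr.
Qed.

Lemma symbol_omega U A u v : symbol (omega U A) u v =
  symbol A (fun i => \sum_j U j i * u j) (fun i => \sum_j conjc (U j i) * v j).
Proof.
rewrite /symbol /omega adj_tau -!mulmxA tau_coherent !mulmxA.
rewrite -[tau n U]trmxK -trmx_mul tau_trmx tau_coherent.
have e (f g : 'I_m -> C) : f =1 g -> coherent f = coherent g.
  by move=> fg; apply/matrixP => a i; rewrite !mxE (eq_mon _ fg).
rewrite (e (fun i => \sum_j U^T i j * u j) (fun i => \sum_j U j i * u j)); last first.
  by move=> i; apply: eq_bigr => j _; rewrite mxE.
rewrite (e (fun i => \sum_j adjmx U i j * v j) (fun i => \sum_j conjc (U j i) * v j)) //.
by move=> i; apply: eq_bigr => j _; rewrite !mxE.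
Qed.
End FixedNumber.
End Symbol.

(** * Unitary extension of an orthogonal pair *)

Section UnitaryExtension.
Variable F : numClosedFieldType.
Local Notation "M ^t*" := (map_mx (@Num.conj F) M^T).

(** Gram-Schmidt applied to the rows u, v, 0, ..., 0 yields a unitary matrix. Its first row is
    parallel to [u]; [v] lies in the span of the first two rows and is orthogonal to [u], hence
    parallel to the second. *)
Lemma unitarymx_extend2 m (u v : 'rV[F]_m.+2) : u != 0 -> v != 0 ->
  v *m u ^t* = 0 ->
  exists2 B : 'M[F]_m.+2, B \is unitarymx &
    exists c d, [/\ c != 0, d != 0, row 0 B = c *: u & row 1 B = d *: v].
Proof.
move=> u0 v0 uv.
pose A := \matrix_(i < m.+2) if i == 0 then u else if i == 1 then v else 0.
have rA0 : row 0 A = u by apply/rowP => j; rewrite !mxE eqxx.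
have rA1 : row 1 A = v by apply/rowP => j; rewrite !mxE.
pose B := schmidt A.
have uB : B \is unitarymx by exact: schmidt_unitarymx.
have rB i j : row i B *m (row j B) ^t* = (i == j)%:R%:M.
  by rewrite [LHS]mx11_scalar -dotmxE; congr (_%:M); apply/row_unitarymxP.
exists B => //.
have [c Ec] : exists c, u = c *: row 0 B.
  apply/sub_rVP; rewrite -rA0; apply: submx_trans (row_schmidt_sub A 0) _.
  apply/sumsmx_subP => k; rewrite leqn0 => k0; rewrite genmxE.
  by have -> : k = 0 by apply/val_inj/eqP.
have c0 : c != 0 by apply: contraNneq u0 => c0; rewrite Ec c0 scale0r.
have [[a b] Eab] : exists ab, v = ab.1 *: row 0 B + ab.2 *: row 1 B.
  have /sub_addsmxP[[x y] ->] : (v <= row 0 B + row 1 B)%MS.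
    rewrite -rA1; apply: submx_trans (row_schmidt_sub A 1) _.
    apply/sumsmx_subP => k k1; rewrite genmxE.
    have [->|->] : k = 0 \/ k = 1.
      by case: k k1 => [[|[|?]]] // p _; [left|right]; apply: val_inj.
      exact: addsmxSl.
    exact: addsmxSr.
  exists (x 0 0, y 0 0) => /=.
  by rewrite {1}[x]mx11_scalar {1}[y]mx11_scalar !mul_scalar_mx.
have a0 : a = 0.
  have : v *m (row 0 B) ^t* = 0.
    have -> : row 0 B = c^-1 *: u by rewrite Ec scalerA mulVf // scale1r.
    by rewrite linearZ /= map_mxZ -scalemxAr uv scaler0.
  rewrite Eab mulmxDl -!scalemxAl !rB /= => /matrixP/(_ 0 0).
  by rewrite !mxE /= mulr0n mulr0 addr0 mulr1.
have Eb : v = b *: row 1 B by rewrite Eab /= a0 scale0r add0r.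
have b0 : b != 0 by apply: contraNneq v0 => b0; rewrite Eb b0 scale0r.
exists c^-1, b^-1; split; rewrite ?invr_eq0 //.
  by rewrite Ec scalerA mulVf // scale1r.
by rewrite Eb scalerA mulVf // scale1r.
Qed.
End UnitaryExtension.

(** Every nonzero point of the quadric comes, up to scaling, from the first and the conjugated last
    column of some special unitary matrix. *)
Lemma SU_extend2 (R : realType) m (u w : 'I_m.+2 -> R[i]) :
  (exists i, u i != 0) -> (exists i, w i != 0) -> \sum_i u i * w i = 0 ->
  exists2 U : 'M[R[i]]_m.+2, SU U &
  exists c d, [/\ c != 0, d != 0, forall i, U i ord0 = c * u i &
    forall i, conjc (U i ord_max) = d * w i].
Proof.
move=> [iu u0] [iw w0] uw.
pose ur : 'rV[R[i]]_m.+2 := \row_i u i.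
pose wr : 'rV[R[i]]_m.+2 := \row_i conjc (w i).
have [||| B uB [c [d [c0 d0 Bu Bw]]]] := @unitarymx_extend2 _ m ur wr.
- by apply: contraNneq u0 => /rowP/(_ iu); rewrite !mxE => ->.
- apply: contraNneq w0 => /rowP/(_ iw); rewrite !mxE => /eqP.
  by rewrite conjc_eq0 => /eqP ->.
- apply/matrixP => i j; rewrite !mxE.
  transitivity (conjc (\sum_i u i * w i)); last by rewrite uw rmorph0.
  rewrite rmorph_sum /=; by apply: eq_bigr => k _; rewrite !mxE mulrC rmorphM.
(* Row 1 is moved to the last place. Row 0 is then divided by the determinant, which has modulus
   one, so that unitarity survives and the determinant becomes 1. *)
pose s := tperm 1 (@ord_max m.+1).
pose dt := \det (row_perm s B).
pose e (i : 'I_m.+2) : R[i] := if i == 0 then dt^-1 else 1.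
pose B2 : 'M[R[i]]_m.+2 := \matrix_(i, j) (e i * B (s i) j).
have Bd : \det B * conjc (\det B) = 1.
  have /unitarymxP/(congr1 determinant) := uB.
  by rewrite det_mulmx det1 det_map_mx det_tr.
have dtd : dt * conjc dt = 1.
  rewrite /dt row_permE det_mulmx det_perm rmorphM rmorph_sign mulrACA Bd mulr1.
  by rewrite -expr2 sqrr_sign.
have dt0 : dt != 0.
  by apply: contra_eq_neq dtd => ->; rewrite mul0r eq_sym oner_eq0.
have e1 i : e i * conjc (e i) = 1.
  rewrite /e; case: ifP => _; last by rewrite rmorph1 mulr1.
  by rewrite -[conjc]/(Num.conj) fmorphV -invfM dtd invr1.
have B2u : B2 *m adjmx B2 = 1%:M.
  apply/matrixP => i j; rewrite !mxE.
  have /unitarymxP/matrixP/(_ (s i) (s j)) := uB; rewrite !mxE (inj_eq perm_inj).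
  move=> H; transitivity (e i * conjc (e j) * (i == j)%:R).
    rewrite -H mulr_sumr; apply: eq_bigr => k _; rewrite !mxE rmorphM.
    by rewrite mulrACA.
  by case: eqP => [->|]; rewrite ?mulr0 // e1 mulr1.
have B2d : \det B2 = 1.
  have -> : B2 = diag_mx (\row_i e i) *m row_perm s B.
    by apply/matrixP => i j; rewrite mul_diag_mx !mxE.
  rewrite det_mulmx det_diag (bigD1 0) //= big1 => [|i /negPf i0].
    by rewrite mxE /e eqxx mulr1 mulVf.
  by rewrite mxE /e i0.
exists B2^T.
  split; last by rewrite det_tr.
  have := B2u; rewrite /adjmx => /mulmx1C /(congr1 trmx).
  by rewrite trmx1 trmx_mul -map_trmx trmxK.
have rB0 i : B 0 i = c * u i by have /rowP/(_ i) := Bu; rewrite !mxE.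
have rB1 i : B 1 i = d * conjc (w i) by have /rowP/(_ i) := Bw; rewrite !mxE.
have s0 : s 0 = 0 by rewrite tpermD.
exists (dt^-1 * c), (conjc (e ord_max) * conjc d); split.
- by rewrite mulf_neq0 ?invr_eq0.
- have em0 i : e i != 0.
    by rewrite /e; case: (i == 0); rewrite ?invr_eq0 // oner_eq0.
  by apply: mulf_neq0; rewrite conjc_eq0.
- by move=> i; rewrite !mxE s0 rB0 mulrA.
- by move=> i; rewrite !mxE tpermR rB1 !rmorphM /= conjcK mulrA.
Qed.

(** * Highest weight vectors *)

Section BodyOperators.
Variable R : realType.
Local Notation C := R[i].
Variables m k r : nat.
Local Notation D := (dimH m (k + r)).
Local Notation sq := (@sqrt_fact R m _).

(* Up to the factor r!, the normally ordered k-body operator a^dag^(p.1) a^(p.2). *)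
Definition body_op (p : occ m k * occ m k) : 'M[C]_D := \matrix_(a, b)
  (sq (fock a) * sq (fock b) * \sum_(c : occ m r) r`!%:R / (occ_fact c)%:R *
     ((fock a == occ_add p.1 c) && (fock b == occ_add p.2 c))%:R).

(** The sum over the [r] spectator particles [c] reassembles the power of u.v by the multinomial
    theorem. *)
Lemma symbol_body_op p (u v : 'I_m -> C) : symbol (body_op p) u v =
  mon u p.1 * mon v p.2 * (\sum_j u j * v j) ^+ r.
Proof.
rewrite symbolE -multinomial mulr_sumr.
pose g (c : occ m r) (q : 'I_D * 'I_D) :=
  r`!%:R / (occ_fact c)%:R *
  ((fock q.1 == occ_add p.1 c) && (fock q.2 == occ_add p.2 c))%:R *
  (mon u (fock q.1) * mon v (fock q.2)).
transitivity (\sum_q \sum_c g c q).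
  apply: eq_bigr => q _; rewrite mxE -mulr_suml; congr (_ * _).
  by rewrite mulrAC divff ?mul1r // mulf_neq0 ?sqrt_fact_neq0.
rewrite exchange_big /=; apply: eq_bigr => c _.
rewrite (@sum_single _ _ _ (enum_rank (occ_add p.1 c), enum_rank (occ_add p.2 c))).
  by rewrite /g /= !fock_rank !eqxx mulr1 !mon_add mon_mul; ring.
move=> [a b] nab; rewrite /g /=; case: andP => [[/eqP ea /eqP eb]|_].
  by rewrite -ea -eb /fock !enum_valK eqxx in nab.
by rewrite mulr0 mul0r.
Qed.

Lemma body_op_graded p a b : body_op p a b != 0 -> forall j,
  (cnt (fock a) j + cnt p.2 j = cnt (fock b) j + cnt p.1 j)%N.
Proof.
rewrite mxE mulf_eq0 negb_or => /andP[_ nz] j.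
case: (pickP (fun c : occ m r =>
  (fock a == occ_add p.1 c) && (fock b == occ_add p.2 c))) => [c /andP[]|nc].
  by move=> /eqP -> /eqP ->; rewrite !occ_addE; lia.
by case/eqP: nz; apply: big1 => c _; rewrite nc mulr0.
Qed.

(** All these symbols share the factor (x.z)^r, which is nonzero at positive points and can be
    cancelled, leaving distinct monomials. *)
Lemma body_op_free (y : occ m k * occ m k -> C) :
  (0 < m)%N -> \sum_p y p *: body_op p = 0 -> forall p, y p = 0.
Proof.
move=> m0 H; apply: (@monomials2_free _ _ m (fun p => cnt p.1) (fun p => cnt p.2)).
  by move=> [a b] [a' b'] /= e f; congr (_, _); apply: cnt_inj.
move=> x z x0 z0; pose d : C := \sum_j (x j)%:R * (z j)%:R.
have d0 : d != 0.
  have -> : d = (\sum_j x j * z j)%N%:R.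
    by rewrite natr_sum; apply: eq_bigr => j _; rewrite natrM.
  rewrite pnatr_eq0 -lt0n (bigD1 (Ordinal m0)) //= ltn_addr //.
  by rewrite muln_gt0 x0 z0.
apply: (@mulIf _ (d ^+ r)); first by rewrite expf_neq0.
rewrite mul0r mulr_suml.
transitivity (symbol (\sum_p y p *: body_op p)
   (fun j => (x j)%:R) (fun j => (z j)%:R)); last first.
  by rewrite H /symbol mulmx0 mul0mx mxE.
rewrite symbol_sum; apply: eq_bigr => p _.
by rewrite symbolZ symbol_body_op !mulrA.
Qed.
End BodyOperators.

Section Hop.
Variable R : realType.
Local Notation C := R[i].
Variables m n : nat.
Local Notation D := (dimH m n).
Local Notation sq := (@sqrt_fact R m n).
Implicit Types (x y : occ m n) (i j : 'I_m).

(** The selection rule of [hop], rearranged additively so that it stays in the natural numbers. *)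
Definition hops i j x y : bool :=
  [forall l, cnt x l + (l == j) == cnt y l + (l == i)]%N.

Lemma hopsP i j x y :
  reflect (forall l, cnt x l + (l == j) = cnt y l + (l == i))%N (hops i j x y).
Proof. by apply: (iffP forallP) => H l; apply/eqP/H. Qed.

(** Only the counts at [i] and [j] differ, each by one. This converts the square root in [hop] into
    a ratio of [sqrt_fact] times an integer. *)
Lemma hops_fact i j x y : hops i j x y ->
  (cnt x i * occ_fact y = cnt y j * occ_fact x)%N.
Proof.
move=> /hopsP H; case: (eqVneq i j) => [eij|nij].
  have -> : x = y by apply: cnt_inj => l; have := H l; rewrite eij => /addIn.
  by rewrite eij.
have Hi := H i; have Hj := H j.
rewrite !eqxx (negPf nij) /= in Hi; rewrite !eqxx eq_sym (negPf nij) /= in Hj.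
have nji : j != i by rewrite eq_sym.
rewrite /occ_fact [in LHS](bigD1 i) //= [in LHS](bigD1 j nji) /=.
rewrite [in RHS](bigD1 i) //= [in RHS](bigD1 j nji) /=.
have -> : (\prod_(l | (l != i) && (l != j)) (cnt x l)`! =
           \prod_(l | (l != i) && (l != j)) (cnt y l)`!)%N.
  apply: eq_bigr => l /andP[/negPf li /negPf lj].
  by have := H l; rewrite li lj !addn0 => ->.
have -> : cnt x i = (cnt y i).+1 by lia.
have -> : cnt y j = (cnt x j).+1 by lia.
by rewrite !factS; ring.
Qed.

Lemma hopE i j a b : hop R n i j a b = (hops i j (fock a) (fock b))%:R *
  (sq (fock a) / sq (fock b) * (cnt (fock b) j)%:R).
Proof.
rewrite mxE; set b1 := [forall l, _].
have -> : b1 = hops i j (fock a) (fock b).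
  apply/forallP/hopsP => H l; have := H l; lia.
case: ifP => [Hh|_]; last by rewrite mul0r.
have sb0 := sqrt_fact_neq0 R (fock b).
apply: (mulIf sb0); rewrite mul1r mulrAC divfK // /sqrt_fact.
rewrite -!rmorphM /= -sqrtrM ?ler0n // -natrM.
have -> : (cnt (fock b) j * cnt (fock a) i * occ_fact (fock b) =
   occ_fact (fock a) * (cnt (fock b) j * cnt (fock b) j))%N.
  by rewrite -mulnA (hops_fact Hh); ring.
rewrite natrM sqrtrM ?ler0n // natrM -expr2 sqrtr_sqr ger0_norm ?ler0n //.
by rewrite rmorphM /= rmorph_nat.
Qed.

(* In the unnormalised monomial basis, a^dag_i a_j acts as x_i d/dx_j. *)
Definition unnormalised (X : 'M[C]_D) a b : C :=
  X a b * sq (fock b) / sq (fock a).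

Lemma hop_commutator (X : 'M[C]_D) i j a b :
  (hop R n i j *m X - X *m hop R n i j) a b =
  sq (fock a) / sq (fock b) *
  (\sum_c (hops i j (fock a) (fock c))%:R * (cnt (fock c) j)%:R *
          unnormalised X c b -
   \sum_c unnormalised X a c * (hops i j (fock c) (fock b))%:R *
          (cnt (fock b) j)%:R).
Proof.
have sq0 := @sqrt_fact_neq0 R m n.
rewrite !mxE mulrBr !mulr_sumr; congr (_ - _); apply: eq_bigr => c _.
  by rewrite hopE /unnormalised; field; rewrite !sq0.
by rewrite hopE /unnormalised; field; rewrite !sq0.
Qed.

Lemma hop_commutator_eq0 (X : 'M[C]_D) i j :
  hop R n i j *m X - X *m hop R n i j = 0 <-> forall a b,
  \sum_c (hops i j (fock a) (fock c))%:R * (cnt (fock c) j)%:R *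
     unnormalised X c b =
  \sum_c unnormalised X a c * (hops i j (fock c) (fock b))%:R *
     (cnt (fock b) j)%:R.
Proof.
split=> [H a b|H].
  have /eqP := hop_commutator X i j a b; rewrite H mxE eq_sym !mulf_eq0 invr_eq0.
  by rewrite !(negPf (sqrt_fact_neq0 _ _)) /= subr_eq0 => /eqP.
by apply/matrixP => a b; rewrite hop_commutator H subrr mulr0 mxE.
Qed.

Lemma numopE i : numop R n i = diag_mx (\row_a (cnt (@fock m n a) i)%:R).
Proof.
apply/matrixP => a b; rewrite /numop hopE !mxE.
have -> : hops i i (fock a) (fock b) = (a == b).
  apply/hopsP/eqP => [H|-> //]; apply/fock_inj/cnt_inj => l.
  by have := H l; lia.
case: eqP => [->|]; last by rewrite mul0r.
by rewrite mul1r divff ?mul1r // sqrt_fact_neq0.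
Qed.

Lemma numop_commutator (X : 'M[C]_D) i a b :
  (numop R n i *m X - X *m numop R n i) a b =
  ((cnt (fock a) i)%:R - (cnt (fock b) i)%:R) * X a b.
Proof. by rewrite numopE mul_diag_mx mul_mx_diag !mxE mulrBl [X in _ - X]mulrC. Qed.
End Hop.

Lemma hops_ex m n (z : occ m n) i j : (0 < cnt z j)%N -> exists y, hops i j y z.
Proof.
case: n z => [|n] z zj; first by have := cnt_le z j; rewrite leqNgt zj.
have [y ->] := occ_predP zj; exists (occ_incr i y); apply/hopsP => l.
by rewrite !occ_incrE addnAC [RHS]addnAC -addnA addnCA addnA.
Qed.

(** * Existence and uniqueness of the highest weight vector *)

Section HighestWeight.
Variable R : realType.
Local Notation C := R[i].
Variables m k r : nat.
Local Notation M := m.+2.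
Local Notation n := (k + r)%N.
Local Notation D := (dimH M n).
Local Notation sq := (@sqrt_fact R M _).
Local Notation i0 := (@ord0 m.+1).
Local Notation il := (@ord_max m.+1).
Implicit Types (x y : occ M n) (i j : 'I_M) (X : 'M[C]_D).

(** A nonzero multiple of (a^dag_1)^k (a_m)^k. *)
Definition ladder : 'M[C]_D := body_op R r (occ_single k i0, occ_single k il).

(** Torus weight (k, 0, ..., 0, -k), which is lambda_k modulo (1, ..., 1), again written without
    subtraction. *)
Definition shifted x y : bool :=
  [forall j, cnt x j + k * (j == il) == cnt y j + k * (j == i0)]%N.

Lemma shiftedP x y :
  reflect (forall j, cnt x j + k * (j == il) = cnt y j + k * (j == i0))%N
    (shifted x y).
Proof. by apply: (iffP forallP) => H j; apply/eqP/H. Qed.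

Lemma shifted_le x y : shifted x y -> (k <= cnt y il)%N.
Proof. by move/shiftedP/(_ il); rewrite eqxx /=; lia. Qed.

Lemma shifted_injl x x' y : shifted x y -> shifted x' y -> x = x'.
Proof.
move=> /shiftedP H /shiftedP H'; apply: cnt_inj => j.
by have := H j; have := H' j; lia.
Qed.

Lemma shifted_ex y : (k <= cnt y il)%N -> exists x, shifted x y.
Proof.
move=> ky; pose f j := (cnt y j + k * (j == i0) - k * (j == il))%N.
have fE j : (f j + k * (j == il) = cnt y j + k * (j == i0))%N.
  rewrite /f; case: (eqVneq j il) => [->|_]; lia.
have sum_delta (i : 'I_M) : (\sum_j k * (j == i) = k)%N.
  rewrite -[RHS](occ_single_subproof k i).
  by apply: eq_bigr => j _; case: eqP => _; rewrite ?muln1 ?muln0.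
have sf : (\sum_j f j)%N = n.
  have : (\sum_j (f j + k * (j == il)) = \sum_j (cnt y j + k * (j == i0)))%N.
    by apply: eq_bigr => j _; apply: fE.
  by rewrite !big_split /= sum_cnt !sum_delta => /addIn.
by exists (occ_of sf); apply/shiftedP => j; rewrite occ_ofE fE.
Qed.

(** A single spectator state [c] contributes: [y] with [k] particles removed from the last mode. The
    quotient of the two factorials is the falling factorial. *)
Lemma ladderE a b : ladder a b = r`!%:R * (sq (fock a) / sq (fock b)) *
  (cnt (fock b) il ^_ k)%:R * (shifted (fock a) (fock b))%:R.
Proof.
rewrite mxE /=; set x := fock a; set y := fock b.
have eqc (c : occ M r) : ((x == occ_add (occ_single k i0) c) &&
    (y == occ_add (occ_single k il) c)) =
    shifted x y && (y == occ_add (occ_single k il) c).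
  rewrite andbC [RHS]andbC; case: (eqVneq y) => //= ey.
  have cE (i j : 'I_M) : cnt (occ_add (occ_single k i) c) j = (k * (j == i) + cnt c j)%N.
    by rewrite occ_addE occ_singleE; case: eqP => _; rewrite ?muln1 ?muln0.
  apply/eqP/shiftedP => [ex j|H].
    by rewrite ex ey !cE; lia.
  by apply: cnt_inj => j; have := H j; rewrite ey !cE; lia.
under eq_bigr do rewrite eqc.
case: (boolP (shifted x y)) => [sxy|_] /=; last first.
  by rewrite big1 ?mulr0 // => c _; rewrite mulr0.
have ky := shifted_le sxy.
pose f j := (cnt y j - k * (j == il))%N.
have fE j : (f j + (if j == il then k else 0) = cnt y j)%N.
  rewrite /f; case: (eqVneq j il) => [->|_]; lia.
have sf : (\sum_j f j)%N = r.
  have : (\sum_j (f j + (if j == il then k else 0)) = \sum_j cnt y j)%N.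
    by apply: eq_bigr => j _; apply: fE.
  by rewrite big_split /= sum_cnt occ_single_subproof addnC => /addnI.
pose c0 := occ_of sf.
have ec0 : y = occ_add (occ_single k il) c0.
  by apply: cnt_inj => j; rewrite occ_addE occ_singleE occ_ofE [RHS]addnC fE.
rewrite (@sum_single _ _ _ c0) => [|c nc]; last first.
  case: eqP => [ec|_]; last by rewrite mulr0.
  case/eqP: nc; apply: cnt_inj => j; have : cnt y j = cnt y j by [].
  by rewrite {1}ec ec0 !occ_addE => /addnI.
rewrite -ec0 eqxx !mulr1.
have yf : occ_fact y = (cnt y il ^_ k * occ_fact c0)%N.
  rewrite /occ_fact (bigD1 il) //= [in RHS](bigD1 il) //= occ_ofE /f eqxx muln1.
  rewrite mulnA ffact_fact //; congr (_ * _)%N; apply: eq_bigr => j /negPf nj.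
  by rewrite occ_ofE /f nj muln0 subn0.
have y0 := sqrt_fact_neq0 R y.
have c00 : (occ_fact c0)%:R != 0 :> C by rewrite pnatr_eq0 -lt0n occ_fact_gt0.
have -> : (cnt y il ^_ k)%:R = sq y * sq y / (occ_fact c0)%:R :> C.
  by rewrite sqrt_fact_sq yf natrM mulfK.
by field; rewrite c00.
Qed.

Lemma shifted_num_commutator X : (forall a b, X a b != 0 -> shifted (fock a) (fock b)) ->
  forall i, numop R n i *m X - X *m numop R n i =
    ((i == i0)%:Z * k%:Z - (i == il)%:Z * k%:Z)%:~R *: X.
Proof.
move=> H i; apply/matrixP => a b; rewrite numop_commutator [RHS]mxE.
case: (eqVneq (X a b) 0) => [->|/H/shiftedP/(_ i) e]; first by rewrite !mulr0.
congr (_ * _); rewrite !pmulrn -intrB; congr (_%:~R); lia.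
Qed.

(** For i < j, a^dag_i a_j commutes with a^dag_1 because j is not the first mode, and with a_m
    because i is not the last. *)
Lemma ladder_commutes i j : (i < j)%N ->
  hop R n i j *m ladder - ladder *m hop R n i j = 0.
Proof.
move=> ij; apply/hop_commutator_eq0 => a b.
have sq0 := @sqrt_fact_neq0 R M n.
have uL c d : unnormalised ladder c d = r`!%:R * (cnt (fock d) il ^_ k)%:R *
    (shifted (fock c) (fock d))%:R.
  by rewrite /unnormalised ladderE; field; rewrite !sq0.
under eq_bigr do rewrite uL; under [RHS]eq_bigr do rewrite uL.
set x := fock a; set y := fock b.
have jn0 : (j == i0) = false by apply/eqP => e; move: ij; rewrite e.
have inl : (i == il) = false.
  by apply/eqP => e; move: ij; rewrite e /= ltnNge -ltnS ltn_ord.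
rewrite (sum_fock (fun c => (hops i j x c)%:R * (cnt c j)%:R *
  (r`!%:R * (cnt y il ^_ k)%:R * (shifted c y)%:R))).
rewrite (sum_fock (fun c => r`!%:R * (cnt c il ^_ k)%:R * (shifted x c)%:R *
  (hops i j c y)%:R * (cnt y j)%:R)).
pose T := [forall l, cnt x l + k * (l == il) + (l == j) ==
                     cnt y l + k * (l == i0) + (l == i)]%N.
have TL c : hops i j x c -> shifted c y -> T.
  move=> /hopsP H1 /shiftedP H2; apply/forallP => l; apply/eqP.
  by rewrite addnAC H1 addnAC H2.
have TR c : shifted x c -> hops i j c y -> T.
  move=> /shiftedP H1 /hopsP H2; apply/forallP => l; apply/eqP.
  by rewrite H1 addnAC H2 addnAC.
(* Each sum has at most one nonzero term, and only when x and y satisfy T. *)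
transitivity (r`!%:R * ((cnt y j - k * (j == il)) * cnt y il ^_ k * T)%N%:R : C).
  case: (ltnP (cnt y il) k) => [ly|ky].
    rewrite (ffact_small ly) muln0 mul0n mulr0n mulr0 big1 // => c _.
    by rewrite mul0r mulr0.
  have [c0 hc0] := shifted_ex ky.
  rewrite (@sum_single _ _ _ c0) => [|c nc]; last first.
    case: (boolP (shifted c y)) => [hc|_]; last by rewrite !mulr0.
    by rewrite (shifted_injl hc hc0) eqxx in nc.
  rewrite hc0.
  have -> : hops i j x c0 = T.
    apply/idP/idP => [h|/forallP H]; first exact: TL hc0.
    apply/hopsP => l; apply: (@addIn (k * (l == il))).
    by rewrite addnAC (eqP (H l)) -(shiftedP _ _ hc0 l) addnAC.
  have -> : cnt c0 j = (cnt y j - k * (j == il))%N.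
    by have /shiftedP/(_ j) := hc0; rewrite jn0 muln0 addn0; lia.
  by rewrite !natrM mulr1; ring.
case: (posnP (cnt y j)) => [yj|yj].
  by rewrite yj sub0n !mul0n mulr0n mulr0 big1 // => c _; rewrite mulr0.
have [c0 hc0] := hops_ex i yj; have /hopsP Hc0 := hc0.
rewrite [RHS](@sum_single _ _ _ c0) => [|c nc]; last first.
  case: (boolP (hops i j c y)) => [/hopsP hc|_]; last by rewrite mulr0 mul0r.
  by case/eqP: nc; apply: cnt_inj => l; have := hc l; rewrite -Hc0 => /addIn.
rewrite hc0.
have -> : shifted x c0 = T.
  apply/idP/idP => [h|/forallP H]; first exact: TR hc0.
  apply/shiftedP => l; apply: (@addIn (l == j)).
  by rewrite (eqP (H l)) [RHS]addnAC Hc0 addnAC.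
have -> : cnt c0 il = (cnt y il - (j == il))%N.
  by have := Hc0 il; rewrite ![il == _]eq_sym inl addn0 => <-; rewrite addnK.
rewrite mulr1 -!natrM; congr (_%:R).
case: (eqVneq j il) => [e|_]; last by rewrite /= muln0 !subn0; ring.
(* When j is the last mode, the two coefficients agree by the two ways of peeling a factor off the
   falling factorial of order k+1. *)
have := ffactnS (cnt y il) k; rewrite ffactnSr e /= muln1 subn1 => eff.
transitivity (r`! * (cnt y il ^_ k * (cnt y il - k)) * T)%N; first by ring.
by rewrite eff; ring.
Qed.

Lemma ladder_hw : hw_vector (@lam M k) ladder.
Proof.
have sq0 := @sqrt_fact_neq0 R M n.
split; last split.
(* At the column (r, 0, ..., 0, k) the falling factorial is k!, so the entry is nonzero. *)
- pose y : occ M n := occ_add (occ_single k il) (occ_single r i0).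
  have ky : cnt y il = k by rewrite occ_addE !occ_singleE eqxx /= addn0.
  have [x hx] : exists x, shifted x y by apply: shifted_ex; rewrite ky.
  apply/eqP => /matrixP/(_ (enum_rank x) (enum_rank y)).
  rewrite ladderE !fock_rank hx ky ffactnn mxE mulr1 => /eqP.
  by rewrite !mulf_eq0 invr_eq0 !(negPf (sq0 _)) !pnatr_eq0 !(gtn_eqF (fact_gt0 _)).
- exists (fun i => (i == i0)%:Z * k%:Z - (i == il)%:Z * k%:Z); split.
    apply: shifted_num_commutator => a b.
    by rewrite ladderE mulf_eq0 negb_or => /andP[_]; case: shifted; rewrite ?eqxx.
  have H i : (i == i0)%:Z * k%:Z - (i == il)%:Z * k%:Z = (lam k i)%:Z - k%:Z.
    rewrite /lam -!val_eqE /=; case: eqP => [->|] /=; last case: eqP => _; lia.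
  by move=> i j; rewrite !H; lia.
- exact: ladder_commutes.
Qed.

Lemma sum_lam : (\sum_(i < M) lam k i = M * k)%N.
Proof.
rewrite big_ord_recl big_ord_recr /= /lam /= eqxx.
rewrite (eq_bigr (fun=> k)) => [|i _].
  by rewrite sum_nat_const card_ord; lia.
by rewrite /bump /= !add1n eqSS (ltn_eqF (ltn_ord i)).
Qed.

(** An SU weight fixes [w] only up to a common constant. Both indices carry [n] particles, so [w]
    sums to zero, which forces that constant to be [-k]. *)
Lemma hw_shifted X : hw_vector (@lam M k) X ->
  forall a b, X a b != 0 -> shifted (fock a) (fock b).
Proof.
move=> [_ [[w [Hw wl]] _]] a b Xab.
set x := fock a; set y := fock b.
have wE i : w i = (cnt x i)%:Z - (cnt y i)%:Z.
  have /matrixP/(_ a b) := Hw i; rewrite numop_commutator [RHS]mxE.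
  move/(mulIf Xab) => e; apply: (@intr_inj C).
  by rewrite -e intrB.
have wk i : w i = (lam k i)%:Z + w il.
  have := wl i il; rewrite /lam /= eqxx /=; lia.
have sw : \sum_i w i = 0.
  rewrite (eq_bigr _ (fun i _ => wE i)) sumrB -!(big_morph Posz PoszD (erefl _)).
  by rewrite !sum_cnt subrr.
have wil : w il = - k%:Z.
  move: sw; rewrite (eq_bigr _ (fun i _ => wk i)) big_split /=.
  rewrite -(big_morph Posz PoszD (erefl _)) sum_lam sumr_const card_ord.
  rewrite -mulr_natl natz PoszM -mulrDr => /eqP; rewrite mulf_eq0 /= => /eqP; lia.
apply/shiftedP => j; have := wE j; rewrite wk wil /lam -!val_eqE /=.
case: eqP => [->|_] /=; last case: eqP => _; lia.
Qed.

(* The hops 1 <- j lead from every supported matrix entry to those in the column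
   of the Fock state (r, 0, ..., 0, k). *)
Lemma hop_path X : (forall a b, X a b != 0 -> shifted (fock a) (fock b)) ->
  (forall j, (i0 < j)%N -> hop R n i0 j *m X - X *m hop R n i0 j = 0) ->
  (forall a b, (forall j, j != i0 -> (cnt (fock b) j <= k * (j == il))%N) -> X a b = 0) ->
  X = 0.
Proof.
move=> supp comm base; apply/matrixP => a b; rewrite mxE.
have sq0 := @sqrt_fact_neq0 R M n.
(* Induction on the number of particles of the column state outside the first mode. *)
have [N leN] := ubnP (n - cnt (fock b) i0)%N.
elim: N a b leN => // N IH a b leN; apply/eqP; apply: contraT => Xab.
have sab := supp _ _ Xab; have /shiftedP Sab := sab.
case: (boolP [forall j, (j != i0) ==> (cnt (fock b) j <= k * (j == il))%N]).
  move=> /forallP H; case/eqP: Xab; apply: base => j jn.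
  exact: (implyP (H j)).
rewrite negb_forall => /existsP[j]; rewrite negb_imply -ltnNge => /andP[jn jk].
have aj : (0 < cnt (fock a) j)%N.
  have := Sab j; rewrite (negPf jn) muln0 addn0 => e; move: jk.
  by rewrite -e -[X in (X < _)%N]add0n ltn_add2r.
(* The commutator is read at row [a'], which is [a] with one particle moved from [j] to the first
   mode. On the right, the columns have one more particle in the first mode and vanish by induction;
   on the left, only row [a] remains, with the factor [cnt (fock a) j > 0]. *)
have [x' hx'] := hops_ex i0 aj; pose a' : 'I_D := enum_rank x'.
have ha' : hops i0 j (fock a') (fock a) by rewrite fock_rank.
have j0 : (i0 < j)%N by rewrite lt0n; apply: contraNneq jn => e; apply/eqP/val_inj.
have := (hop_commutator_eq0 X i0 j).1 (comm j j0) a' b.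
rewrite [RHS]big1 => [|c _]; last first.
  case: (boolP (hops i0 j (fock c) (fock b))) => [/hopsP hc|_]; last first.
    by rewrite mulr0 mul0r.
  rewrite /unnormalised IH ?mul0r //.
  have := hc i0; rewrite eqxx eq_sym (negPf jn) addn0 => e.
  have : (cnt (fock c) i0 <= n)%N by exact: cnt_le.
  by move: leN; lia.
rewrite (@sum_single _ _ _ a) => [|c nc]; last first.
  case: (boolP (hops i0 j (fock a') (fock c))) => [/hopsP hc|_]; last by rewrite !mul0r.
  case/eqP: nc; apply/fock_inj/cnt_inj => l.
  by have /hopsP/(_ l) := ha'; rewrite hc => /addIn.
rewrite ha' mul1r /unnormalised => /eqP.
rewrite !mulf_eq0 invr_eq0 !(negPf (sq0 _)) !orbF pnatr_eq0 (gtn_eqF aj) /=.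
by rewrite (negPf Xab).
Qed.

(** Subtracting the multiple of [ladder] that agrees with [X] at one entry leaves an operator
    satisfying the same linear conditions and vanishing on the base column; [hop_path] then kills
    it. *)
Lemma hw_unique X : hw_vector (@lam M k) X -> exists c, X = c *: ladder.
Proof.
move=> hX; have sX := hw_shifted hX; have [_ [_ cX]] := hX.
have sq0 := @sqrt_fact_neq0 R M n.
pose y : occ M n := occ_add (occ_single k il) (occ_single r i0).
have ky : cnt y il = k by rewrite occ_addE !occ_singleE eqxx /= addn0.
have [x hx] : exists x, shifted x y by apply: shifted_ex; rewrite ky.
pose a0 : 'I_D := enum_rank x; pose b0 : 'I_D := enum_rank y.
have L0 : ladder a0 b0 != 0.
  rewrite ladderE !fock_rank hx ky ffactnn mulr1.
  by rewrite !mulf_neq0 ?invr_eq0 // pnatr_eq0 -lt0n fact_gt0.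
have [_ [_ cL]] := ladder_hw.
exists (X a0 b0 / ladder a0 b0); apply/eqP; rewrite -subr_eq0; apply/eqP.
set c := _ / _.
have entryE (A B : 'M[C]_D) d a b : (A - d *: B) a b = A a b - d * B a b.
  by rewrite !mxE.
have supp a b : (X - c *: ladder) a b != 0 -> shifted (fock a) (fock b).
  rewrite entryE; apply: contraR => nsh.
  have -> : X a b = 0 by apply/eqP; apply: contraNT nsh => /sX.
  have -> : ladder a b = 0 by rewrite ladderE (negPf nsh) mulr0.
  by rewrite mulr0 subrr.
apply: (hop_path supp) => [j ij|a b Hb].
  rewrite mulmxBr mulmxBl -scalemxAr -scalemxAl.
  have /subr0_eq -> := cX _ _ ij; have /subr0_eq -> := cL _ _ ij.
  exact: subrr.
apply/eqP; apply: contraT => nz; have := supp _ _ nz => sab.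
(* The support forces at least [k] particles in the last mode and [Hb] allows at most [k], with none
   in the middle modes. *)
have eb : fock b = y.
  have kb := shifted_le sab.
  have bj j : j != i0 -> cnt (fock b) j = cnt y j.
    move=> jn; have := Hb j jn; rewrite occ_addE !occ_singleE (negPf jn) addn0.
    by case: eqP => [->|_]; lia.
  apply: cnt_inj => j; case: (eqVneq j i0) => [->|/bj //].
  have : (\sum_j cnt (fock b) j = \sum_j cnt y j)%N by rewrite !sum_cnt.
  rewrite (bigD1 i0) // [in RHS](bigD1 i0) //=.
  by rewrite (eq_bigr (cnt y)) => [/addIn|].
have ea : fock a = x by move: sab; rewrite eb => /shifted_injl; apply.
move: nz; have -> : a = a0 by apply: fock_inj; rewrite fock_rank.
have -> : b = b0 by apply: fock_inj; rewrite fock_rank.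
by rewrite entryE /c divfK // subrr eqxx.
Qed.
End HighestWeight.

(** * Polynomials on the quadric *)

Section Quadric.
Variable F : numFieldType.
Variables m k : nat.
Local Notation M := m.+2.
Local Notation pairs := (occ M k * occ M k)%type.
Local Notation i0 := (@ord0 m.+1).

(* On the quadric \sum_i u i * w i = 0 these monomials are a basis: u_0 w_0 is
   eliminated through the remaining u_i w_i. *)
Definition reduced (p : pairs) : bool := (cnt p.1 i0 == 0) || (cnt p.2 i0 == 0).

(** Normal form of a monomial modulo the equation of the quadric. The weight clause serves the
    diagonal trace, the last clause the independence of the resulting operators. *)
Definition quadric_expansion (p : pairs) (c : pairs -> F) : Prop :=
  [/\ forall u w : 'I_M -> F, \sum_i u i * w i = 0 ->
        mon u p.1 * mon w p.2 = \sum_b c b * (mon u b.1 * mon w b.2),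
      forall b, c b != 0 -> reduced b,
      forall b, c b != 0 ->
        forall j, (cnt p.1 j + cnt b.2 j = cnt p.2 j + cnt b.1 j)%N &
      reduced p -> forall b, c b = (b == p)%:R].
End Quadric.

(** Replacing one factor u_0 w_0 by minus the sum of the other u_j w_j lowers the exponent of u_0
    and preserves the torus weight. *)
Lemma quadric_expansion_ex (F : numFieldType) m k (p : occ m.+2 k * occ m.+2 k) :
  exists c : _ -> F, quadric_expansion p c.
Proof.
have [N leN] := ubnP (cnt p.1 ord0); elim: N p leN => // N IH p leN.
case: (boolP (reduced p)) => [rp|].
  exists (fun b => (b == p)%:R); split=> // [u w _|b|b].
  - by rewrite (@sum_single _ _ _ p) ?eqxx ?mul1r // => b /negPf ->; rewrite mul0r.
  - by case: (eqVneq b p) => [->|_]; rewrite ?eqxx.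
  - by case: (eqVneq b p) => [-> _ j|_]; [rewrite addnC | rewrite eqxx].
rewrite negb_or -!lt0n => /andP[p1 p2].
case: k p leN p1 p2 IH => [|k] [al be] /= leN al0 be0 IH.
  by have := cnt_le al ord0; rewrite leqNgt al0.
have [al' Eal] := occ_predP al0; have [be' Ebe] := occ_predP be0.
pose q j : occ m.+2 k.+1 * occ m.+2 k.+1 :=
  (occ_incr j al', occ_incr j be').
have [c Hc] : exists c : 'I_m.+2 -> _ -> F, forall j, j != ord0 ->
    quadric_expansion (q j) (c j).
  apply: (@fin_all_exists _ _ (fun j c => j != ord0 -> quadric_expansion (q j) c)) => j.
  case: (eqVneq j ord0) => [_|nj]; first by exists (fun=> 0).
  have [|c Hc] := IH (q j); last by exists c.
  move: leN; by rewrite Eal /q /= !occ_incrE eqxx eq_sym (negPf nj).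
exists (fun b => - \sum_(j | j != ord0) c j b).
have nz b : - \sum_(j | j != ord0) c j b != 0 -> exists2 j, j != ord0 & c j b != 0.
  rewrite oppr_eq0 => H.
  case: (pickP (fun j => (j != ord0) && (c j b != 0))) => [j /andP[]|n0]; first by exists j.
  by case/eqP: H; apply: big1 => j nj; have := n0 j; rewrite nj /= => /negbFE/eqP.
split=> [u w uw|b /nz[j /Hc[_ + _ _]]|b /nz[j /Hc[_ _ + _]]|].
- have -> : mon u al * mon w be = u ord0 * w ord0 * (mon u al' * mon w be').
    by rewrite Eal Ebe !mon_incr; ring.
  have -> : u ord0 * w ord0 = - \sum_(j | j != ord0) u j * w j.
    by move: uw; rewrite (bigD1 ord0) //= => /eqP; rewrite addr_eq0 => /eqP.
  under [RHS]eq_bigr do rewrite mulNr mulr_suml.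
  rewrite sumrN exchange_big mulNr mulr_suml; congr (- _); apply: eq_bigr => j nj.
  have [<- // _ _ _] := Hc j nj.
  by rewrite !mon_incr; ring.
- by move=> H; apply: H.
- move=> H cb l; have := H b cb l; rewrite Eal Ebe /q /= !occ_incrE; lia.
- by rewrite /reduced /= !eqn0Ngt al0 be0.
Qed.

(** The quadric is parametrised by u = (s, x) and w = (-q, s z) with q = x.z over the nonzero
    indices. The power of [s] separates the exponents of index 0, and ordinary independence of
    monomials handles the rest. *)
Lemma quadric_free (F : numFieldType) m k (c : occ m.+2 k * occ m.+2 k -> F) :
  (forall u w : 'I_m.+2 -> F, (exists i, u i != 0) -> (exists i, w i != 0) ->
     \sum_i u i * w i = 0 ->
     \sum_(b | reduced b) c b * (mon u b.1 * mon w b.2) = 0) ->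
  forall b, reduced b -> c b = 0.
Proof.
move=> H b0 rb0.
pose i0 := @ord0 m.+1.
(* This is the exponent of [s]. As one of the two counts at index 0 is zero for a reduced pair,
   their difference determines both. *)
pose e (b : occ m.+2 k * occ m.+2 k) := (cnt b.1 i0 + (k - cnt b.2 i0))%N.
have e_inj b : reduced b -> e b = e b0 ->
    cnt b.1 i0 = cnt b0.1 i0 /\ cnt b.2 i0 = cnt b0.2 i0.
  have := cnt_le b.2 i0; have := cnt_le b0.2 i0; move: rb0.
  by rewrite /reduced /e -/i0 => /orP[/eqP|/eqP] + + + /orP[/eqP|/eqP]; lia.
pose c1 b := if reduced b && (e b == e b0) then c b else 0.
suff : forall b, c1 b = 0 by move/(_ b0); rewrite /c1 rb0 eqxx.
apply: (@monomials2_free F _ m.+2 (fun b => cnt b.1) (fun b => cnt b.2) c1).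
  by move=> [a b] [a' b'] /= ea eb; congr (_, _); apply: cnt_inj.
move=> x z x0 z0.
pose q : F := \sum_(j | j != i0) (x j)%:R * (z j)%:R.
have q0 : q != 0.
  have -> : q = (\sum_(j | j != i0) x j * z j)%N%:R.
    by rewrite natr_sum; apply: eq_bigr => j _; rewrite natrM.
  by rewrite pnatr_eq0 -lt0n (bigD1 ord_max) //= ltn_addr // muln_gt0 x0 z0.
pose X (a : occ m.+2 k) : F := \prod_(j | j != i0) (x j)%:R ^+ cnt a j.
pose Z (a : occ m.+2 k) : F := \prod_(j | j != i0) (z j)%:R ^+ cnt a j.
pose c' b := if reduced b then c b * ((- q) ^+ cnt b.2 i0 * X b.1 * Z b.2) else 0.
have := @sum_pow_eq0 F _ e c' _ (e b0).
move=> E; have {E} : \sum_(b | e b == e b0) c' b = 0.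
  apply: E => s s0.
  pose u j : F := if j == i0 then s%:R else (x j)%:R.
  pose w j : F := if j == i0 then - q else s%:R * (z j)%:R.
  have sF : s%:R != 0 :> F by rewrite pnatr_eq0 -lt0n.
  have uw : \sum_i u i * w i = 0.
    rewrite (bigD1 i0) //= /u /w eqxx.
    rewrite (eq_bigr (fun j => s%:R * ((x j)%:R * (z j)%:R))) => [|j /negPf ->].
      by rewrite -mulr_sumr -/q mulrN addNr.
    by rewrite mulrCA.
  rewrite -[RHS](H u w) //; last first.
  - by exists i0; rewrite /w eqxx oppr_eq0.
  - by exists i0; rewrite /u eqxx.
  rewrite [RHS]big_mkcond; apply: eq_bigr => b _; rewrite /c'.
  case: (reduced b); last by rewrite mul0r.
  have -> : mon u b.1 = s%:R ^+ cnt b.1 i0 * X b.1.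
    rewrite /mon (bigD1 i0) //= /u eqxx; congr (_ * _).
    by apply: eq_bigr => j /negPf ->.
  have -> : mon w b.2 = (- q) ^+ cnt b.2 i0 * (s%:R ^+ (k - cnt b.2 i0) * Z b.2).
    rewrite /mon (bigD1 i0) //= {1}/w eqxx; congr (_ * _).
    have -> : (k - cnt b.2 i0 = \sum_(j | j != i0) cnt b.2 j)%N.
      by rewrite -[X in (X - _)%N](sum_cnt b.2) (bigD1 i0) //= addKn.
    rewrite -prodrXr -big_split; apply: eq_bigr => j /negPf nj.
    by rewrite /w nj exprMn.
  rewrite /e exprD; ring.
(* All pairs with this exponent of [s] share the same power of [-q], which is cancelled; the missing
   variables of index 0 enter as a common factor. *)
have qk0 : (- q) ^+ cnt b0.2 i0 != 0 by rewrite expf_neq0 // oppr_eq0.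
move=> E; apply: (mulfI qk0); rewrite mulr0.
transitivity ((x i0)%:R ^+ cnt b0.1 i0 * (z i0)%:R ^+ cnt b0.2 i0 *
  \sum_(b | e b == e b0) c' b); last by rewrite E mulr0.
rewrite !mulr_sumr [RHS]big_mkcond; apply: eq_bigr => b _; rewrite /c' /c1.
case: (boolP (reduced b)) => rb /=; last by rewrite mul0r !mulr0 if_same.
case: eqP => [/(e_inj _ rb)[e1 e2]|_]; last by rewrite mul0r mulr0.
have -> : \prod_j (x j)%:R ^+ cnt b.1 j = (x i0)%:R ^+ cnt b0.1 i0 * X b.1.
  by rewrite (bigD1 i0) //= e1.
have -> : \prod_j (z j)%:R ^+ cnt b.2 j = (z i0)%:R ^+ cnt b0.2 i0 * Z b.2.
  by rewrite (bigD1 i0) //= e2.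
by rewrite e2; ring.
Qed.

(** * Dimension and diagonal trace *)

Section Counting.

Lemma card_occ m n : #|occ m.+1 n| = 'C(n + m, m).
Proof.
rewrite card_sig addnC -card_ord_partitions.
pose h (t : m.+1.-tuple 'I_n.+1) : {ffun 'I_m.+1 -> 'I_n.+1} := [ffun j => tnth t j].
have inj_h : injective h.
  move=> s t /ffunP e; apply: eq_from_tnth => j.
  by have := e j; rewrite !ffunE.
rewrite -(card_imset _ inj_h); apply: eq_card => f; rewrite !inE.
apply/idP/imsetP => [sf|[t]].
  exists [tuple f j | j < m.+1].
    by rewrite inE big_tuple; under eq_bigr do rewrite tnth_mktuple.
  by apply/ffunP => j; rewrite ffunE tnth_mktuple.
rewrite inE big_tuple => /eqP st ->; apply/eqP; rewrite -[RHS]st.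
by apply: eq_bigr => j _; rewrite ffunE.
Qed.

(** Adding a particle to the first mode is a bijection from degree k-1 onto the complement, and
    Pascal's rule gives the difference. *)
Lemma card_occ_eq0 m k : #|[set x : occ m.+2 k | cnt x ord0 == 0]| = 'C(k + m, m).
Proof.
pose E := [set x : occ m.+2 k | cnt x ord0 != 0].
suff cE : #|E| = 'C(k + m, m.+1).
  have := cardsC [set x : occ m.+2 k | cnt x ord0 == 0].
  rewrite card_occ addnS binS -cE addnC => /eqP.
  have -> : ~: [set x : occ m.+2 k | cnt x ord0 == 0] = E.
    by apply/setP => x; rewrite !inE.
  by rewrite eqn_add2l => /eqP.
rewrite {}/E; case: k => [|k].
  rewrite bin_small //; apply/eqP; rewrite cards_eq0; apply/eqP/setP => x.
  by rewrite !inE; have := cnt_le x ord0; rewrite leqn0 => ->.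
rewrite addSnnS -card_occ -cardsT.
have inj_incr : injective (@occ_incr m.+2 k ord0).
  move=> x y e; apply: cnt_inj => j; have := occ_incrE ord0 x j.
  by rewrite e occ_incrE => /addnI.
rewrite -(card_imset _ inj_incr); apply/eq_card => x; rewrite !inE.
apply/idP/imsetP => [|[y _ ->]]; last by rewrite occ_incrE eqxx.
by rewrite -lt0n => /occ_predP[y ->]; exists y.
Qed.

Lemma card_reduced_diag m k :
  #|[set p : occ m.+2 k * occ m.+2 k | reduced p && (p.1 == p.2)]| = 'C(k + m, m).
Proof.
rewrite -card_occ_eq0.
have inj_diag : injective (fun x : occ m.+2 k => (x, x)) by move=> x y [].
rewrite -(card_imset _ inj_diag); apply: eq_card => -[x y]; rewrite !inE /reduced /=.
apply/andP/imsetP => [[rx /eqP exy]|[z]].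
  by exists x; rewrite -?exy // inE; move: rx; rewrite -exy orbb.
by rewrite inE => z0 [-> ->]; rewrite z0.
Qed.

(** With d monomials in all and f of them without the first variable, the count is d^2 - (d-f)^2 =
    f(2d-f), where (m+1) d = (k+m+1) f. *)
Lemma card_reduced m k :
  (#|[set p : occ m.+2 k * occ m.+2 k | reduced p]| * m.+1 =
   'C(k + m, m) * ('C(k + m, m) * (2 * k + m.+1)))%N.
Proof.
set B := [set p | _]; set f0 := 'C(k + m, m).
pose E := [set x : occ m.+2 k | cnt x ord0 != 0].
have EN : (#|E| + f0 = 'C(k + m.+1, m.+1))%N.
  rewrite -card_occ /f0 -card_occ_eq0 addnC -(cardsC [set x : occ m.+2 k | cnt x ord0 == 0]).
  by congr (_ + _)%N; apply: eq_card => x; rewrite !inE.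
have BC : (#|B| + #|E| * #|E| = (#|E| + f0) * (#|E| + f0))%N.
  rewrite EN -card_occ -card_prod -(cardsC B) -cardsX; congr (_ + _)%N.
  by apply: eq_card => -[x y]; rewrite !inE /reduced negb_or.
have Hb : (m.+1 * (#|E| + f0) = (k + m.+1) * f0)%N.
  by rewrite EN -mul_bin_diag addnS.
have Bf : (#|B| = f0 * (2 * #|E| + f0))%N by move: BC; nia.
rewrite Bf -!mulnA; congr (_ * _)%N; nia.
Qed.
End Counting.

(** Unitarity makes x.z invariant under the substitution of [symbol_omega], so the spectator factor
    (x.z)^r is untouched by [omega]. *)
Lemma SU_dot (R : realType) m (U : 'M[R[i]]_m) (x z : 'I_m -> R[i]) : SU U ->
  \sum_i (\sum_j U j i * x j) * (\sum_j conjc (U j i) * z j) = \sum_j x j * z j.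
Proof.
move=> [UU _].
have H j l : \sum_i U j i * conjc (U l i) = (j == l)%:R.
  have /matrixP/(_ j l) := UU; rewrite !mxE => <-.
  by apply: eq_bigr => i _; rewrite !mxE.
transitivity (\sum_j \sum_l (\sum_i U j i * conjc (U l i)) * (x j * z l)).
  under [RHS]eq_bigr do under eq_bigr do rewrite mulr_suml.
  under [RHS]eq_bigr do rewrite exchange_big.
  rewrite [RHS]exchange_big; apply: eq_bigr => i _; rewrite mulr_suml.
  apply: eq_bigr => j _; rewrite mulr_sumr; apply: eq_bigr => l _.
  by rewrite mulrACA.
apply: eq_bigr => j _; rewrite (@sum_single _ _ _ j) => [|l /negPf lj].
  by rewrite H eqxx mul1r.
by rewrite H eq_sym lj mul0r.
Qed.

Lemma SU_col_orthogonal (R : realType) m (U : 'M[R[i]]_m) i j : SU U -> i != j ->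
  \sum_l U l i * conjc (U l j) = 0.
Proof.
move=> [/mulmx1C/matrixP/(_ j i) H _] /negPf ij.
move: H; rewrite !mxE eq_sym ij mulr0n => H; rewrite -[RHS]H.
by apply: eq_bigr => l _; rewrite !mxE mulrC.
Qed.

(** * A basis of the lambda_k-component and the trace of its projector *)

Section Component.
Variable R : realType.
Local Notation C := R[i].
Variables m k r : nat.
Local Notation M := m.+2.
Local Notation D := (dimH M (k + r)).
Local Notation pairs := (occ M k * occ M k)%type.
Local Notation i0 := (@ord0 m.+1).
Local Notation il := (@ord_max m.+1).

Variable coef : pairs -> pairs -> C.
Hypothesis coefP : forall p, quadric_expansion p (coef p).

(** The multinomial coefficients in the expansion of (u.x)^k (w.z)^k. *)
Definition multiplicity (p : pairs) : C :=
  k`!%:R / (occ_fact p.1)%:R * (k`!%:R / (occ_fact p.2)%:R).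

Lemma multiplicity_neq0 p : multiplicity p != 0.
Proof.
by rewrite /multiplicity !mulf_neq0 ?invr_eq0 // pnatr_eq0 -lt0n
  ?fact_gt0 ?occ_fact_gt0.
Qed.

(** The operator coefficient of the reduced monomial [b] in the orbit of [ladder], seen as a
    function on the quadric. *)
Definition component_op (b : pairs) : 'M[C]_D :=
  \sum_p (multiplicity p * coef p b) *: body_op R r p.

(** The symbol is (u.x)^k (w.z)^k (x.z)^r with u and w columns of [U] on the quadric; the monomials
    in u and w are put in normal form and collected. *)
Lemma omega_ladder U : SU U -> omega U (ladder R m k r) =
  \sum_(b | reduced b) (mon (fun i => U i i0) b.1 *
     mon (fun i => conjc (U i il)) b.2) *: component_op b.
Proof.
move=> sU; apply: symbol_inj => x z.
rewrite symbol_omega symbol_body_op /= !mon_single SU_dot // symbol_sum.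
pose u i : C := U i i0; pose w i : C := conjc (U i il).
have uw : \sum_i u i * w i = 0 by apply: SU_col_orthogonal.
set S := (\sum_j x j * z j) ^+ r; pose T (p : pairs) := mon x p.1 * mon z p.2 * S.
transitivity (\sum_p multiplicity p * (mon u p.1 * mon w p.2) * T p).
  rewrite -!multinomial mulr_suml mulr_suml.
  rewrite -(pair_big xpredT xpredT (fun a b => multiplicity (a, b) *
    (mon u a * mon w b) * T (a, b))) /=.
  apply: eq_bigr => a _; rewrite mulr_sumr mulr_suml; apply: eq_bigr => b _.
  by rewrite !mon_mul /multiplicity /T /=; ring.
transitivity (\sum_p \sum_(b | reduced b) mon u b.1 * mon w b.2 *
    (multiplicity p * coef p b * T p)).
  apply: eq_bigr => p _; have [/(_ u w uw) -> Hr _ _] := coefP p.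
  rewrite mulr_sumr mulr_suml [RHS]big_mkcond; apply: eq_bigr => b _.
  case: (boolP (reduced b)) => [_|nb]; first by ring.
  have -> : coef p b = 0 by apply/eqP; apply: contraNT nb; apply: Hr.
  by rewrite mul0r mulr0 mul0r.
rewrite exchange_big; apply: eq_bigr => b _.
rewrite symbolZ symbol_sum mulr_sumr; apply: eq_bigr => p _.
by rewrite symbolZ symbol_body_op.
Qed.

(** Both [body_op] and the normal form respect the torus weight, so row minus column equals [b.1]
    minus [b.2]. *)
Lemma component_op_graded b a a' : component_op b a a' != 0 ->
  (a == a') = (b.1 == b.2).
Proof.
rewrite summxE => nz.
case: (pickP (fun p => (coef p b != 0) && (body_op R r p a a' != 0))) => [p|n0].
  move=> /andP[cpb /body_op_graded H]; have [_ _ /(_ b cpb) H' _] := coefP p.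
  apply/eqP/eqP => [e|e]; [apply: cnt_inj|apply/fock_inj/cnt_inj] => j.
    by have := H j; have := H' j; rewrite e; lia.
  by have := H j; have := H' j; rewrite e; lia.
case/eqP: nz; apply: big1 => p _; rewrite mxE; have := n0 p.
case: (eqVneq (coef p b) 0) => [-> _|_ /= /negbFE/eqP ->].
  by rewrite mulr0 mul0r.
by rewrite mulr0.
Qed.

Definition reducedset : {set pairs} := [set p | reduced p].
Local Notation N := #|reducedset|.

Definition component_basis : 'M[C]_(N, D * D) :=
  \matrix_(i < N) mxvec (component_op (enum_val i)).

Lemma row_component_basis i :
  row i component_basis = mxvec (component_op (enum_val i)).
Proof. exact: rowK. Qed.

Lemma enum_reduced (i : 'I_N) : reduced (enum_val i).
Proof. by have := enum_valP i; rewrite inE. Qed.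

Lemma sum_reduced (V : nmodType) (g : pairs -> V) :
  \sum_(b | reduced b) g b = \sum_(i < N) g (enum_val i).
Proof. by rewrite -(big_enum_val g); apply: eq_bigl => b; rewrite inE. Qed.

(** On reduced [p] the coefficients [coef p] form the identity matrix, and the [body_op] are
    independent. *)
Lemma component_basis_free : row_free component_basis.
Proof.
apply: inj_row_free => v v0.
have sv : \sum_(i < N) v 0 i *: component_op (enum_val i) = 0.
  apply: (can_inj mxvecK); rewrite linear0 -v0 mulmx_sum_row linear_sum /=.
  by apply: eq_bigr => i _; rewrite rowK linearZ.
have free : forall p, multiplicity p * \sum_(i < N) v 0 i * coef p (enum_val i) = 0.
  apply: (@body_op_free R M k r _ isT); rewrite -[RHS]sv.
  under [RHS]eq_bigr do rewrite scaler_sumr.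
  rewrite exchange_big; apply: eq_bigr => p _.
  rewrite mulr_sumr scaler_suml; apply: eq_bigr => i _.
  by rewrite scalerA mulrCA.
apply/rowP => i; rewrite mxE; have /eqP := free (enum_val i).
rewrite mulf_eq0 (negPf (multiplicity_neq0 _)) /= => /eqP <-.
have [_ _ _ /(_ (enum_reduced i)) cE] := coefP (enum_val i).
rewrite (@sum_single _ _ _ i) => [|j nj]; first by rewrite cE eqxx mulr1.
by rewrite cE (inj_eq enum_val_inj) (negPf nj) mulr0.
Qed.

Lemma omegaZ U c (X : 'M[C]_D) : omega U (c *: X) = c *: omega U X.
Proof. by rewrite /omega -scalemxAr -scalemxAl. Qed.

(** One inclusion expands the orbit of [ladder], which gives all highest weight vectors up to scale.
    For the other, a linear form vanishing on [W] gives a polynomial vanishing on the quadric, whose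
    reduced coefficients are its values on the basis. *)
Lemma component_eqmx W : @lam_component R M (k + r) k W -> (W == component_basis)%MS.
Proof.
move=> [Wgen Wmin]; apply/andP; split.
  (* Minimality of [W] quantifies over square matrices, so the basis is replaced by a square
     generator of its row space. *)
  rewrite -(genmxE component_basis); apply: Wmin => U X sU /hw_unique[c ->].
  rewrite genmxE omegaZ omega_ladder // linearZ scalemx_sub // linear_sum.
  rewrite sum_reduced; apply: summx_sub => i _ /=.
  rewrite linearZ; apply: scalemx_sub; rewrite -[X in (X <= _)%MS]row_component_basis.
  exact: row_sub.
rewrite submxE; apply/eqP/matrixP => i j; rewrite [RHS]mxE.
pose y b := (mxvec (component_op b) *m cokermx W) 0 j.
have -> : (component_basis *m cokermx W) i j = y (enum_val i).
  by rewrite /y -row_component_basis -row_mul [RHS]mxE.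
apply: quadric_free (enum_reduced i) => u w u0 w0 uw.
have [U sU [c [d [c0 d0 Uc Ud]]]] := SU_extend2 u0 w0 uw.
have := Wgen U _ sU (ladder_hw R m k r); rewrite submxE => /eqP/matrixP/(_ 0 j).
rewrite omega_ladder // linear_sum mulmx_suml summxE [RHS]mxE => H.
have cd0 : c ^+ k * d ^+ k != 0 by rewrite mulf_neq0 ?expf_neq0.
apply: (mulfI cd0); rewrite mulr0 -[RHS]H mulr_sumr; apply: eq_bigr => b _.
rewrite linearZ -scalemxAl mxE -/(y b).
by rewrite (eq_mon _ Uc) (eq_mon _ Ud) !mon_scale; ring.
Qed.

(** The sum is the trace of [P] times the projector [Pi] onto diagonal operators. The basis is
    graded, so [Pi] acts on it by the 0-1 diagonal matrix [Dl], and cyclicity reduces the trace to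
    that of [Dl]. *)
Lemma trace_graded (P : 'M[C]_(D * D)) : P *m P = P -> (P == component_basis)%MS ->
  \sum_a P (mxvec_index a a) (mxvec_index a a) =
  #|[set p : pairs | reduced p && (p.1 == p.2)]|%:R.
Proof.
move=> PP /andP[/submxP[Q PQ] /submxP[Y GY]].
pose Pi : 'M[C]_(D * D) := diag_mx (mxvec 1%:M).
pose Dl : 'M[C]_N := diag_mx (\row_i ((enum_val i).1 == (enum_val i).2)%:R).
(* [P] fixes its row space, and the basis rows can be cancelled by freeness. *)
have GQ : component_basis *m Q = 1%:M.
  apply: (row_free_inj component_basis_free).
  by rewrite /= mul1mx -mulmxA -PQ {1}GY -mulmxA PP -GY.
have GPi : component_basis *m Pi = Dl *m component_basis.
  apply/row_matrixP => i; rewrite -[Pi]/(diag_mx _) !row_mul rowK.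
  rewrite row_diag_mx -scalemxAl -rowE rowK mxE -[RHS]linearZ /=.
  rewrite mul_mx_diag; apply/rowP => ab; case/mxvec_indexP: ab => a a'.
  rewrite mxE !mxvecE !mxE.
  case: (eqVneq (component_op (enum_val i) a a') 0) => [->|/component_op_graded ->].
    by rewrite mul0r mulr0.
  by rewrite mulrC.
transitivity (\tr (P *m Pi)).
  rewrite /mxtrace [RHS](reindex _ (curry_mxvec_bij _ _)) /=.
  transitivity (\sum_a \sum_b (P *m Pi) (mxvec_index a b) (mxvec_index a b)).
    apply: eq_bigr => a _; rewrite (@sum_single _ _ _ a) => [|b nb].
      by rewrite mul_mx_diag mxE mxvecE mxE eqxx mulr1.
    by rewrite mul_mx_diag mxE mxvecE mxE eq_sym (negPf nb) mulr0.
  by rewrite pair_bigA; apply: eq_bigr => -[].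
rewrite {1}PQ -mulmxA GPi mxtrace_mulC -mulmxA GQ mulmx1 mxtrace_diag.
rewrite (eq_bigr _ (fun i _ => mxE _ _ _ i)).
rewrite -(sum_reduced (fun b : pairs => (b.1 == b.2)%:R)).
rewrite -sum1_card natr_sum [RHS](eq_bigl (fun p : pairs => reduced p && (p.1 == p.2))).
  by rewrite [RHS]big_mkcondr; apply: eq_bigr => b _; case: eqP.
by move=> p; rewrite inE.
Qed.
End Component.

Theorem theoremT4 (R : realType) (m n k : nat) :
  (2 <= m)%N -> (k <= n)%N ->
  forall W P : 'M[R[i]]_(dimH m n * dimH m n),
  @lam_component R m n k W -> @orth_projector R m n W P ->
  @frame_eig R m n P =
    ((m - 1)%N%:R / (2 * k + m - 1)%N%:R) / ('C(k + m - 2, k))%:R.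
Proof.
case: m => [|[|m]] // _ /subnKC <-; move: (n - k)%N => r W P HW [PP [_ PW]].
have [coef coefP] : exists coef : _ -> _ -> R[i],
    forall p : occ m.+2 k * occ m.+2 k, quadric_expansion p (coef p).
  by apply: fin_all_exists => p; apply: quadric_expansion_ex.
have WG := component_eqmx coefP HW.
have PG : (P == component_basis r coef)%MS.
  apply/eqmxP/(eqmx_trans (eqmxP PW)); exact/eqmxP.
rewrite /frame_eig (trace_graded coefP PP PG) card_reduced_diag (eqmxP PG).
rewrite (eqP (component_basis_free r coefP)).
have -> : (m.+2 - 1 = m.+1)%N by lia.
have -> : (2 * k + m.+2 - 1 = 2 * k + m.+1)%N by lia.
have -> : (k + m.+2 - 2 = k + m)%N by lia.
rewrite -[in RHS]bin_sub ?leq_addr // addKn.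
have := card_reduced m k; rewrite -/(reducedset m k).
set B := #|_|; set f := 'C(_, _) => /(congr1 (fun x => x%:R : R[i])).
rewrite !natrM => E.
have f0 : f%:R != 0 :> R[i] by rewrite pnatr_eq0 -lt0n bin_gt0 leq_addl.
have m0 : m.+1%:R != 0 :> R[i] by rewrite pnatr_eq0.
have q0 : (2 * k + m.+1)%:R != 0 :> R[i] by rewrite pnatr_eq0 addnS.
have B0 : B%:R != 0 :> R[i].
  apply: contraTneq isT => B0; move/eqP: E; rewrite B0 mul0r eq_sym.
  by rewrite !mulf_eq0 (negPf f0) (negPf q0).
(* The casts are generalised to field variables; the claim f/b = m'/(q f) is then the relation b m'
   = f^2 q from [card_reduced]. *)
move: B%:R f%:R m.+1%:R (2 * k + m.+1)%:R E f0 m0 q0 B0 => b f' m' q E f0 m0 q0 B0.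
apply: (mulfI B0); apply: (mulIf m0); rewrite mulVKf //.
have -> : b * (m' / q / f') * m' = b * m' * (m' / q / f') by ring.
by rewrite E; field; rewrite f0 q0.
Qed.
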